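(* For every graph $H$ with $\chi(H)\ge 3$ and every $\delta>0$, there exists a constant $C>0$ such that the following holds: for every $\eta>0$ there is $n_0$ such that for all $n\ge n_0$ and all integers $m$ with $Cn^{2-1/m_2(H)}\le m\le\binom n2$, the number of labelled $H$-free graphs on vertex set $[n]$ with exactly $m$ edges that are not $(\delta,\chi(H)-1)$-partite is at most $\eta$ times the number of all labelled $H$-free graphs on $[n]$ with exactly $m$ edges. (That is, almost all $H$-free graphs with $n$ vertices and $m$ edges are $(\delta,\chi(H)-1)$-partite.)
   Context: $\chi(H)$ is the chromatic number. For a graph $H$ with at least three vertices, $m_2(H)=\max\{(e(H')-1)/(v(H')-2): H'\subseteq H,\ v(H')\ge 3\}$. A graph is $H$-free if it contains no (not necessarily induced) subgraph isomorphic to $H$. A graph $G$ is $(\delta,k)$-partite if $G$ can be made $k$-partite by removing at most $\delta e(G)$ edges. *)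

(* Defs.v *)
From HB Require Import structures.
From mathcomp Require Import all_boot all_order all_algebra.
From mathcomp Require Import reals exp.

Set Implicit Arguments.
Unset Strict Implicit.
Unset Printing Implicit Defensive.

Import Order.TTheory GRing.Theory Num.Theory.

Record sgraph (T : finType) := SGraph {
  edges : {set {set T}};
  edgesP : [forall e in edges, #|e| == 2]
}.

HB.instance Definition _ (T : finType) := [isSub for @edges T].
HB.instance Definition _ (T : finType) := [Finite of sgraph T by <:].

Section Graphs.
Variable T : finType.
Implicit Types (G : sgraph T) (D : {set {set T}}).

Definition adj G : rel T := fun x y => [set x; y] \in edges G.

Lemma adj_irrefl G x : adj G x x = false.
Proof.
apply/negP => /(implyP (forallP (edgesP G) _)).
by rewrite setUid cards1.
Qed.

(* Color classes may be empty. *)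
Definition kpartite (k : nat) G : bool :=
  [exists c : {ffun T -> 'I_k}, forall x, forall y, adj G x y ==> (c x != c y)].

Lemma kpartite_card G : exists k, kpartite k G.
Proof.
exists #|T|; apply/existsP; exists [ffun x => enum_rank x].
apply/forallP => x; apply/forallP => y; apply/implyP => xy; rewrite !ffunE.
by apply: contraTneq xy => /enum_rank_inj ->; rewrite adj_irrefl.
Qed.

Definition chromatic_number G : nat := ex_minn (kpartite_card G).

Lemma del_edges_subproof G D : [forall e in edges G :\: D, #|e| == 2].
Proof.
apply/forall_inP => e /setDP[eG _].
exact: (forall_inP (edgesP G)).
Qed.

Definition del_edges G D : sgraph T := SGraph (del_edges_subproof G D).

Definition delta_partite (R : realType) (delta : R) (k : nat) G : bool :=
  [exists D : {set {set T}},
    [&& D \subset edges G,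
        (#|D|%:R <= delta * #|edges G|%:R)%R
      & kpartite k (del_edges G D)]].

(* A subgraph is encoded as the pair K of its vertex set K.1 and its edge set
   K.2; it need be neither induced nor spanning. *)
Definition is_subgraph G (K : {set T} * {set {set T}}) : bool :=
  (K.2 \subset edges G) && [forall e in K.2, e \subset K.1].

Definition density2 (R : realType) (K : {set T} * {set {set T}}) : R :=
  ((#|K.2|%:R - 1) / (#|K.1|%:R - 2%:R))%R.

(* The maximum starts at the density of G itself, which is one of the terms
   as soon as 3 <= #|T|; so no spurious default value enters.  The value is
   meaningless when #|T| < 3. *)
Definition m2 (R : realType) G : R :=
  \big[Num.max/density2 R ([set: T], edges G)]_(
      K | is_subgraph G K && (3 <= #|K.1|)) density2 R K.

End Graphs.

Definition iso_to (V T : finType) (H : sgraph V)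
    (K : {set T} * {set {set T}}) : bool :=
  [exists f : {ffun V -> T},
    [&& injectiveb f, [set f x | x in V] == K.1
      & [set f @: e | e : {set V} in edges H] == K.2]].

Definition subgraph_free (V T : finType) (H : sgraph V) (G : sgraph T) : bool :=
  ~~ [exists K, is_subgraph G K && iso_to H K].

(* Main.v *)
(* Hypergraph containers. A copy of H is a hyperedge on the set of pairs of
   vertices, and an H-free graph is an independent set. The definition of m_2
   bounds the degrees of sets of pairs exactly as needed for containers whose
   fingerprints have O(n^(2-1/m_2)) edges; iterating, every H-free graph lies in
   one of few containers A with few copies of H.

   Few copies of H force few cliques K_(r+1), where r = chi(H) - 1, and a robust
   version of Furedi's proof of stability then gives an r-colouring with defect
   D (the edges of A inside colour classes) such that |A| + |D| is at most the
   Turán number t plus o(n^2). A graph in A that is not (delta,r)-partite has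
   more than delta m edges in D, so at most 2^(-delta m) C(|A| + |D|, m) graphs
   in A are bad, while there are at least C(t, m) H-free graphs. If m is close to
   t, stability applied to the graph itself shows that no graph is bad. *)

Require Import Defs.
From mathcomp Require Import all_boot all_order all_algebra.
From mathcomp Require Import reals exp.
From mathcomp Require Import boolp.
From mathcomp Require Import ring lra zify.

Set Implicit Arguments.
Unset Strict Implicit.
Unset Printing Implicit Defensive.

Import Order.TTheory GRing.Theory Num.Theory.

Local Open Scope ring_scope.

(** C is fixed before eta, so the bad proportion must tend to 0 while all constants but n_0 depend
    on delta and H only. The gain 2^(-delta m) is split into four equal factors. One pays for
    replacing C(t + o(n^2), m) by C(t, m), which is cheap only while t - m is of order n^2; hence
    the separate treatment of m close to t. Two pay for the choice of the fingerprints, whose total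
    size is at most a small multiple of m once C is large. The last one, 2^(-delta m/4), is below
    eta for large n because m >= n.

    Bounding |A| + |D| by one inequality avoids a dichotomy between containers well below the Turán
    number and nearly extremal ones, where D is small.

    Fingerprints come from maximality instead of an algorithm: the property that is maximized
    depends on the hypergraph alone, so the vertices it excludes from the independent set can be
    read off from the fingerprint. *)

Lemma card_bigcup_le (I X : finType) (P : pred I) (F : I -> {set X}) :
  (#|\bigcup_(i | P i) F i| <= \sum_(i | P i) #|F i|)%N.
Proof.
elim/big_rec2: _ => [|i n U _ Un]; first by rewrite cards0.
by rewrite (leq_trans (leq_card_setU _ _).1) ?leq_add2l.
Qed.

(** * Containers *)

(* [coverable s0 Good L fam]: every [I] in [fam] lies in a good container that
   is determined by [L] subsets of [I] (the fingerprint) of size at most [s0]. *)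
Section Coverable.
Variables (X : finType) (s0 : nat) (Good : {set X} -> Prop).

Definition coverable L (fam : {set X} -> Prop) :=
  exists F : seq {set X} -> {set X}, forall I, fam I ->
    exists T, [/\ size T = L, {in T, forall S : {set X}, S \subset I /\ (#|S| <= s0)%N},
      I \subset F T & Good (F T)].

Lemma coverable_sub L (fam fam' : {set X} -> Prop) :
  (forall I, fam I -> fam' I) -> coverable L fam' -> coverable L fam.
Proof. by move=> sub [F FP]; exists F => I /sub/FP. Qed.

Lemma coverable_void L (fam : {set X} -> Prop) :
  (forall I, ~ fam I) -> coverable L fam.
Proof. by move=> fam0; exists (fun=> set0) => I /fam0. Qed.

Lemma coverable_container (A : {set X}) (fam : {set X} -> Prop) :
  Good A -> (forall I, fam I -> I \subset A) -> coverable 0 fam.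
Proof. by move=> GA famA; exists (fun=> A) => I /famA IA; exists [::]. Qed.

(** The first entry of the fingerprint selects, by choice over the finitely many sets [S], the
    function that decodes the remaining entries. *)
Lemma coverable_cons L (fam : {set X} -> Prop)
    (fam' : {set X} -> {set X} -> Prop) :
  (forall I, fam I -> exists S : {set X}, [/\ S \subset I, (#|S| <= s0)%N & fam' S I]) ->
  (forall S, coverable L (fam' S)) -> coverable L.+1 fam.
Proof.
move=> famP /fin_all_exists[F FP].
exists (fun T => if T is S1 :: T' then F S1 T' else set0) => I /famP[S [SI Ss0 famS]].
have [T [sT TI IF GF]] := FP S I famS.
exists (S :: T); split=> //=; first by rewrite sT.
by move=> S'; rewrite inE => /orP[/eqP->|/TI].
Qed.

(** Branches of the construction stop at different depths; empty fingerprints bring them to a common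
    length. *)
Lemma coverable_pad k L (fam : {set X} -> Prop) :
  coverable L fam -> coverable (k + L) fam.
Proof.
move=> cL; elim: k => // k IH; rewrite addSn.
apply: (coverable_cons (fam' := fun _ => fam)) => // I famI.
by exists set0; rewrite sub0set cards0.
Qed.

End Coverable.

(** * Weighted hypergraphs, degrees and links *)

Section Degrees.
Variables (R : realFieldType) (X : finType).
Implicit Types (w g : {set X} -> R) (A S e : {set X}).

Definition deg w S := \sum_(e : {set X} | S \subset e) w e.

Definition weighting l A w :=
  forall e : {set X}, 0 <= w e /\ (w e != 0 -> #|e| = l /\ e \subset A).

Lemma deg0E w : deg w set0 = \sum_(e : {set X}) w e.
Proof. by apply: eq_bigl => e; rewrite sub0set. Qed.

Lemma degD w g S : deg (fun e => w e + g e) S = deg w S + deg g S.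
Proof. exact: big_split. Qed.

Lemma sum_degE w : \sum_S deg w S = \sum_(e : {set X}) 2 ^+ #|e| * w e.
Proof.
under eq_bigr do rewrite /deg big_mkcond /=.
rewrite exchange_big /=; apply: eq_bigr => e _.
rewrite -big_mkcond /= sumr_const -natrX mulr_natl -card_powerset.
by congr (_ *+ _); apply: eq_card => S; rewrite inE.
Qed.

Lemma sum_deg1E w A l : weighting l A w ->
  \sum_(v in A) deg w [set v] = l%:R * deg w set0.
Proof.
move=> ww; under eq_bigr do rewrite /deg big_mkcond /=.
rewrite exchange_big deg0E mulr_sumr /=; apply: eq_bigr => e _.
have [->|we] := eqVneq (w e) 0.
  by rewrite mulr0 big1 // => v _; case: ifP.
have [<- eA] := (ww e).2 we.
rewrite -big_mkcondr /= sumr_const mulr_natl; congr (_ *+ _).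
apply: eq_card => v; rewrite unfold_in /= sub1set andbC.
by case ve: (v \in e) => //; rewrite (subsetP eA _ ve).
Qed.

Definition link w (v : X) e := if v \in e then 0 else w (v |: e).

Lemma deg_link_in w v S : v \in S -> deg (link w v) S = 0.
Proof.
move=> vS; apply: big1 => e /subsetP Se.
by rewrite /link Se.
Qed.

Lemma deg_link w v S : v \notin S -> deg (link w v) S = deg w (v |: S).
Proof.
move=> vS; rewrite /deg /link.
rewrite (bigID (fun e : {set X} => v \in e)) /= big1 ?add0r; last first.
  by move=> e /andP[_ ->].
rewrite [RHS](reindex_onto (fun e => v |: e) (fun e => e :\ v)) /=; last first.
  by move=> e; rewrite subUset sub1set => /andP[/setD1K].
apply: eq_big => [e|e /andP[_ /negbTE->]//].
rewrite subUset sub1set setU11 /=; apply/andP/andP => [[Se ve]|[Se /eqP <-]].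
  split; first by rewrite (subset_trans Se) // subsetUr.
  by rewrite setU1K.
by rewrite setD11; split=> //; rewrite subsetD1 Se.
Qed.

End Degrees.

Section PartialLink.
Variables (R : realFieldType) (X : finType).
Implicit Types (w g : {set X} -> R) (A S T e : {set X}).

(* A maximal [S] inside an independent set [I] for which [partial_link S] holds
   either has the full size, and then [g] is a hypergraph of lower uniformity in
   which [I] is still independent, or all vertices extending [S] lie outside [I]. *)
Definition link_bound l (K : R) := 2 ^+ (l + 4) * K ^+ 2 + 2 * K.

Definition partial_link l A w (p tau K : R) S := exists g,
  [/\ weighting l A g,
      forall e, g e != 0 -> exists2 s, s \in S & (s \notin e) && (w (s |: e) != 0),
      #|S|%:R * (tau / 2) <= deg g set0, deg g set0 <= #|S|%:R * (K * tau)
    & forall T, T != set0 -> deg g T <= link_bound l K * p ^+ #|T| * tau].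

Variables (l : nat) (A : {set X}) (w : {set X} -> R) (N p tau K : R).
Hypotheses (K0 : 0 < K) (p0 : 0 < p) (tau0 : 0 < tau).
Hypothesis wA : weighting l.+1 A w.
Hypothesis w_total : N * tau <= deg w set0.
Hypothesis w_deg :
  forall v T, v \notin T -> deg w (v |: T) <= K * p ^+ #|T| * tau.

Lemma partial_link0 : partial_link l A w p tau K set0.
Proof.
exists (fun _ => 0); have d0 T : deg (fun _ => 0 : R) T = 0 by apply: big1.
rewrite d0 cards0 !mul0r; split=> // [e|e|T _]; rewrite ?eqxx //.
rewrite d0 !mulr_ge0 ?exprn_ge0 ?(ltW p0) ?(ltW tau0) // addr_ge0 //.
  by rewrite mulr_ge0 ?exprn_ge0 // ltW.
by rewrite mulr_ge0 // ltW.
Qed.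

(** On a set where [g] is at most half saturated, the link of [v] fits into the other half. Any
    other set lies in no edge of [w'], so the link contributes nothing there. *)
Lemma partial_link_extend S g (w' : {set X} -> R) v :
    (forall e, 0 <= w' e <= w e) ->
    weighting l A g ->
    (forall e, g e != 0 -> exists2 s, s \in S & (s \notin e) && (w (s |: e) != 0)) ->
    #|S|%:R * (tau / 2) <= deg g set0 -> deg g set0 <= #|S|%:R * (K * tau) ->
    (forall T, T != set0 -> deg g T <= link_bound l K * p ^+ #|T| * tau) ->
    (forall T e, T != set0 -> T \subset e -> w' e != 0 ->
       deg g T <= link_bound l K / 2 * p ^+ #|T| * tau) ->
    v \notin S -> tau / 2 <= deg w' [set v] ->
  partial_link l A w p tau K (v |: S).
Proof.
move=> w'w gA gS gS1 gS2 gT w'T vS w'v.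
have w'_le T : deg w' T <= deg w T by apply: ler_sum => e _; case/andP: (w'w e).
have w'0 e : w e = 0 -> w' e = 0.
  by move=> we0; apply/eqP; rewrite eq_le andbC -{2}we0.
exists (fun e => g e + link w' v e); split.
- move=> e; have [g0 gl] := gA e; rewrite /link; case: ifPn => ve.
    by rewrite addr0.
  have [w'0e _] := andP (w'w (v |: e)).
  split; first by rewrite addr_ge0.
  have [ge0|/gl//] := eqVneq (g e) 0; rewrite ge0 add0r => w'e.
  have [|sz veA] := (wA (v |: e)).2 _; first by apply: contra_neq w'e; exact: w'0.
  by move: sz; rewrite cardsU1 ve add1n => -[->]; rewrite (subset_trans _ veA) // subsetUr.
- move=> e; have [ge0|ge _] := eqVneq (g e) 0.
    rewrite ge0 add0r /link; case: ifPn => [|ve w've]; first by rewrite eqxx.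
    exists v; rewrite ?setU11 // ve /=; apply: contra_neq w've; exact: w'0.
  by have [s sS se] := gS e ge; exists s => //; rewrite inE sS orbT.
- rewrite degD deg_link ?inE // setU0 cardsU1 vS natrD mulrDl mul1r addrC.
  exact: lerD.
- rewrite degD deg_link ?inE // setU0 cardsU1 vS natrD mulrDl mul1r addrC.
  rewrite lerD // (le_trans (w'_le _)) //.
  by have := @w_deg v set0; rewrite inE cards0 setU0 expr0 mulr1; apply.
move=> T T0; rewrite degD.
have [vT|vT] := boolP (v \in T); first by rewrite deg_link_in // addr0 gT.
have pT : 0 <= p ^+ #|T| * tau by rewrite mulr_ge0 ?exprn_ge0 ?(ltW p0) ?(ltW tau0).
have [gT'|gT'] := leP (deg g T) (link_bound l K / 2 * p ^+ #|T| * tau).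
  have : deg (link w' v) T <= K * p ^+ #|T| * tau.
    by rewrite deg_link // (le_trans (w'_le _)) // w_deg.
  (* Needs [K] to be at most half of [link_bound l K]: the reason for the summand [2 * K]. *)
  have : K * (p ^+ #|T| * tau) <= link_bound l K / 2 * (p ^+ #|T| * tau).
    apply: ler_wpM2r => //; rewrite /link_bound.
    have : 0 <= 2 ^+ (l + 4) * K ^+ 2 by rewrite mulr_ge0 ?exprn_ge0 // ltW.
    by lra.
  by rewrite !mulrA; move: gT'; lra.
rewrite [deg (link _ _) _]big1 ?addr0 ?gT // => e Te.
rewrite /link; case: ifPn => // ve; apply: contraTeq gT' => w've.
rewrite -leNgt; apply: w'T w've => //.
by rewrite (subset_trans Te) // subsetUr.
Qed.

(* [heavy] sets have half-saturated degree in [g]. Double counting shows that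
   edges of [w] containing a heavy set carry at most a quarter of the weight, and
   the link of [v] in the remaining edges may be added to [g]. *)
Lemma card_extensions S : #|A|%:R <= N -> #|S|%:R <= 2 * p * N ->
    partial_link l A w p tau K S ->
  N / (4 * K) <= #|[set v in A | `[< partial_link l A w p tau K (v |: S) >]]|%:R.
Proof.
move=> AN SpN phiS; have [g [gA gS gS1 gS2 gT]] := phiS.
have N0 : 0 <= N by rewrite (le_trans _ AN).
pose K' := link_bound l K.
have K'0 : 0 < K'.
  by rewrite addr_gt0 // mulr_gt0 // ?exprn_gt0.
pose heavy T := (T != set0) && (K' / 2 * p ^+ #|T| * tau < deg g T).
pose bad e := [exists T, heavy T && (T \subset e)].
pose w' e := if bad e then 0 else w e.
have w0 e : 0 <= w e by case: (wA e).
have g0 e : 0 <= g e by case: (gA e).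
have w'w e : 0 <= w' e <= w e by rewrite /w'; case: ifP; rewrite ?lexx ?w0.
have lossE : deg w set0 - deg w' set0 <= \sum_(T | heavy T) deg w T.
  rewrite !deg0E -sumrB; under [leRHS]eq_bigr do rewrite /deg big_mkcond /=.
  rewrite exchange_big /=; apply: ler_sum => e _; rewrite /w'.
  case: ifPn => [/existsP[T /andP[hT Te]]|_].
    rewrite subr0 (bigD1 T) //= Te lerDl sumr_ge0 // => T' _.
    by case: ifP.
  by rewrite subrr sumr_ge0 // => T' _; case: ifP.
have heavyE T : heavy T -> p * deg w T <= 2 * K / K' * deg g T.
  case/andP=> T0 /ltW hT; have /set0Pn[v vT] := T0.
  apply: (@le_trans _ _ (K * p ^+ #|T| * tau)).
    have := @w_deg v (T :\ v); rewrite setD11 setD1K // => /(_ isT).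
    rewrite (cardsD1 v T) vT exprS => /(ler_wpM2l (ltW p0)).
    by move/le_trans; apply; rewrite le_eqVlt; apply/orP; left; apply/eqP; ring.
  have -> : K * p ^+ #|T| * tau = 2 * K / K' * (K' / 2 * p ^+ #|T| * tau).
    by field; rewrite gt_eqF.
  by rewrite ler_wpM2l // mulr_ge0 ?invr_ge0 ?mulr_ge0 // ltW.
have sum_g : \sum_T deg g T <= 2 ^+ l * deg g set0.
  rewrite sum_degE deg0E mulr_sumr; apply: ler_sum => e _.
  have [->|ge] := eqVneq (g e) 0; first by rewrite !mulr0.
  by have [->] := (gA e).2 ge.
have loss : p * (deg w set0 - deg w' set0) <= p * (N * tau / 4).
  apply: le_trans (ler_wpM2l (ltW p0) lossE) _; rewrite mulr_sumr.
  apply: le_trans (ler_sum _ heavyE) _; rewrite -mulr_sumr.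
  have cK : 0 <= 2 * K / K' by rewrite mulr_ge0 ?invr_ge0 ?mulr_ge0 // ltW.
  apply: (@le_trans _ _ (2 * K / K' * (2 ^+ l * (2 * p * N * (K * tau))))).
    rewrite ler_wpM2l //; apply: (@le_trans _ _ (\sum_T deg g T)).
      rewrite [leRHS](bigID heavy) /= lerDl sumr_ge0 // => T _.
      by rewrite sumr_ge0.
    apply: le_trans sum_g _; rewrite ler_wpM2l ?exprn_ge0 //.
    apply: le_trans gS2 _; rewrite ler_wpM2r // mulr_ge0 // ltW //.
  (* The summand [2 ^+ (l + 4) * K ^+ 2] of [link_bound] is there to make the last factor at most
     1. *)
  have -> : 2 * K / K' * (2 ^+ l * (2 * p * N * (K * tau))) =
     p * (N * tau / 4) * (2 ^+ (l + 4) * K ^+ 2 / K').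
    by rewrite exprD; field; rewrite gt_eqF.
  rewrite ler_piMr ?mulr_ge0 ?invr_ge0 ?(ltW p0) ?(ltW tau0) //.
  by rewrite ler_pdivrMr // mul1r lerDl mulr_ge0 // ltW.
rewrite ler_pM2l // in loss.
set E := [set v in A | _].
(* Vertices outside [E] have degree at most [tau / 2] in [w'], so together they account for at most
   N tau / 2. The degrees sum to at least 3/4 N tau, and the difference forces [E] to be large. *)
have sum_w' : \sum_(v in A) deg w' [set v] <= #|E|%:R * (K * tau) + N * (tau / 2).
  rewrite (bigID (mem E)) /= lerD //.
    apply: (@le_trans _ _ (\sum_(v in E) deg w' [set v])).
      rewrite le_eqVlt; apply/orP; left; apply/eqP; apply: eq_bigl => v.
      by rewrite inE; case: (v \in A).
    rewrite mulr_natl -sumr_const; apply: ler_sum => v _.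
    apply: (@le_trans _ _ (deg w [set v])).
      by apply: ler_sum => e _; case/andP: (w'w e).
    by have := @w_deg v set0; rewrite inE cards0 setU0 expr0 mulr1; apply.
  apply: (@le_trans _ _ (\sum_(v in A) (tau / 2))).
    rewrite big_mkcondr /=; apply: ler_sum => v vA; case: ifPn => [|_]; last first.
      by rewrite divr_ge0 // ltW.
    rewrite inE vA /=; apply: contraNT; rewrite -ltNge => /ltW w'v.
    apply/asboolP; have [vS|vS] := boolP (v \in S).
      by rewrite (setUidPr _) // sub1set.
    apply: (@partial_link_extend S g w') => // T e T0 Te.
    rewrite /w'; case: ifPn => [|nb _]; first by rewrite eqxx.
    rewrite leNgt; apply: contra nb => hT.
    by apply/existsP; exists T; rewrite /heavy T0 hT.
  by rewrite sumr_const -[_ *+ _]mulr_natl ler_wpM2r // divr_ge0 // ltW.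
have w'A : weighting l.+1 A w'.
  move=> e; case/andP: (w'w e) => -> _; split=> //.
  by rewrite /w'; case: ifP => [|_ /((wA e).2)//]; rewrite eqxx.
rewrite (sum_deg1E w'A) in sum_w'.
have : deg w' set0 <= l.+1%:R * deg w' set0.
  rewrite ler_peMl // ?ler1n //; apply: sumr_ge0 => e _.
  by case/andP: (w'w e).
rewrite ler_pdivrMr ?mulr_gt0 // => w'1.
rewrite -(ler_pM2r tau0).
by move: w'1 sum_w' loss w_total; nra.
Qed.

End PartialLink.

(* Stated in continuation-passing style, so that it can be iterated. *)
Lemma container_step (R : realFieldType) (l : nat) (K : R) : 0 < K ->
  exists2 d : R, 0 < d & forall (X : finType) (A : {set X}) (w : {set X} -> R)
    (N p tau : R) (s0 L : nat) (Good fam : {set X} -> Prop),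
  0 < p <= d -> 0 < tau -> 0 < N -> #|A|%:R <= N ->
  p * N <= s0%:R <= 2 * p * N ->
  weighting l A w -> N * tau <= deg w set0 ->
  (forall v (T : {set X}), v \notin T -> deg w (v |: T) <= K * p ^+ #|T| * tau) ->
  (forall I : {set X}, fam I -> I \subset A /\ forall e, w e != 0 -> ~~ (e \subset I)) ->
  (forall A' : {set X}, A' \subset A -> #|A'|%:R <= #|A|%:R - d * N ->
     coverable s0 Good L (fun I => fam I /\ I \subset A')) ->
  coverable s0 Good (l + L) fam.
Proof.
elim: l K => [|l IH] K K0.
  (* In uniformity 0 all weight sits on the empty edge, which lies in every [I]; so the family is
     empty. *)
  exists 1 => // X A w N p tau s0 L Good fam _ tau0 N0 _ _ wA wtot _ famP _.
  apply: coverable_void => I /famP[_ /(_ set0)]; rewrite sub0set => w0.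
  have : 0 < deg w set0 by rewrite (lt_le_trans _ wtot) // mulr_gt0.
  rewrite deg0E (bigD1 set0) //= big1 ?addr0 => [|e e0]; last first.
    apply: contraNeq e0 => we; have [/eqP] := (wA e).2 we.
    by rewrite cards_eq0.
  by move/gt_eqF => w00; move: w0; rewrite w00 => /(_ isT).
(* The next level runs with [p * tau / 2] in place of [tau]; the factor 2 makes up for the
   halving. *)
have K'0 : 0 < 2 * link_bound l K.
  by rewrite mulr_gt0 // addr_gt0 // mulr_gt0 // exprn_gt0.
have [d d0 IHd] := IH _ K'0.
have K16 : 0 < (16 * K)^-1 by rewrite invr_gt0 mulr_gt0.
(* With u = N / (16 K), [ext S] has at least 4u elements and [S] at most 2u, so a container loses at
   least 2u. *)
exists (Num.min d (16 * K)^-1); first by rewrite lt_min d0.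
move=> X A w N p tau s0 L Good fam /andP[p0]; rewrite le_min => /andP[pd pK].
move=> tau0 N0 AN /andP[s0l s0u] wA wtot wdeg famP HA.
pose phi := partial_link l A w p tau K.
pose ext S := [set v in A | `[< phi (v |: S) >]].
(* When [phi S] holds, [ext S] contains the elements of [S] in [A]. They belong to [I] and have to
   be put back. *)
pose A' S := (A :&: S) :|: (A :\: ext S).
pose fam' (S I : {set X}) := [/\ fam I, S \subset I, phi S, (#|S| <= s0)%N &
  (#|S| < s0)%N -> I \subset A' S].
rewrite addSn; apply: (coverable_cons (fam' := fam')) => [I famI|S].
  pose P (S : {set X}) := [&& S \subset I, (#|S| <= s0)%N & `[< phi S >]].
  have P0 : P set0.
    rewrite /P sub0set cards0 /=; apply/asboolP.
    exact: (partial_link0 l A w K0 p0 tau0).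
  case: (@arg_maxnP _ set0 P (fun S => #|S|) P0) => S /and3P[SI Ss0 /asboolP phiS] Smax.
  exists S; split=> //; split=> // Slt; apply/subsetP => v vI.
  have [IA _] := famP I famI; have vA := subsetP IA v vI.
  rewrite !inE vA /= andbT; have [//|vS] := boolP (v \in S).
  apply/asboolP => phiv; have /Smax : P (v |: S).
    by rewrite /P subUset sub1set vI SI cardsU1 vS Slt; apply/asboolP.
  by rewrite /= cardsU1 vS add1n ltnn.
have [phiS|nphi] := pselect (phi S); last by apply: coverable_void => I [].
have [Ss0|Ss0] := leqP #|S| s0; last first.
  by apply: coverable_void => I [_ _ _]; rewrite leqNgt Ss0.
have [Slt|Sge] := ltnP #|S| s0.
  apply: coverable_pad.
  apply: coverable_sub (HA (A' S) _ _) => [I [famI _ _ _ IA']||].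
  - by split=> //; exact: IA'.
  - by rewrite subUset subsetIl subsetDl.
  have := @card_extensions R X l A w N p tau K K0 p0 tau0 wA wtot wdeg S AN.
  have SpN : #|S|%:R <= 2 * p * N by rewrite (le_trans _ s0u) // ler_nat.
  move=> /(_ SpN phiS); rewrite -/(ext S) => extS.
  have cA' : (#|A' S| + #|ext S| <= #|S| + #|A|)%N.
    have sub : ext S \subset A by apply/subsetP => v; rewrite inE => /andP[].
    apply: (@leq_trans (#|S| + (#|A :\: ext S| + #|ext S|))).
      rewrite addnA leq_add2r (leq_trans (leq_card_setU _ _)) // leq_add2r.
      by rewrite subset_leq_card // subsetIr.
    by rewrite leq_add2l cardsD (setIidPr sub) subnK // subset_leq_card.
  have : #|A' S|%:R + #|ext S|%:R <= #|S|%:R + #|A|%:R :> R by rewrite -!natrD ler_nat.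
  have : Num.min d (16 * K)^-1 * N <= (16 * K)^-1 * N.
    by rewrite ler_wpM2r ?ge_min ?lexx ?orbT // ltW.
  have : p * N <= (16 * K)^-1 * N by rewrite ler_wpM2r // ltW.
  move: extS SpN; have -> : N / (4 * K) = 4 * ((16 * K)^-1 * N).
    by field; rewrite gt_eqF.
  by rewrite -mulrA; lra.
have Seq : #|S| = s0 by apply/eqP; rewrite eqn_leq Ss0.
have [g [gA gS gS1 _ gT]] := phiS.
apply: (IHd X A g N p (p * tau / 2) s0 L Good) => //.
- by rewrite p0.
- by rewrite divr_gt0 // mulr_gt0.
- by rewrite s0l.
- rewrite (le_trans _ gS1) // Seq.
  have -> : N * (p * tau / 2) = p * N * (tau / 2) by field.
  by rewrite ler_wpM2r // divr_ge0 // ltW.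
- move=> v T vT; have := gT (v |: T).
  have vT0 : v |: T != set0 by apply/set0Pn; exists v; rewrite setU11.
  rewrite cardsU1 vT exprD expr1 => /(_ vT0)/le_trans; apply.
  by rewrite le_eqVlt; apply/orP; left; apply/eqP; field.
- move=> I [famI SI _ _ _]; have [IA wI] := famP I famI; split=> // e ge.
  apply/negP => eI; have [s sS /andP[_ /wI/negP]] := gS e ge; apply.
  by rewrite subUset eI sub1set (subsetP SI).
- move=> B BA cB; apply: coverable_sub (HA B BA _) => [I [[famI _ _ _ _] IB]//|].
  apply: le_trans cB _; rewrite lerB // ler_wpM2r ?ge_min ?lexx // ltW //.
Qed.

(** * Robust stability *)

Section Cliques.
Variables (R : realFieldType) (T : finType) (e : rel T).
Implicit Types (A X Y : {set T}) (P : rel T).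

Definition nbrs x : {set T} := [set y | e x y].

Fixpoint cliques k X : R :=
  if k is k'.+1 then \sum_(x in X) cliques k' (X :&: nbrs x) else 1.

Lemma cliquesS k X :
  cliques k.+1 X = \sum_(x in X) cliques k (X :&: nbrs x).
Proof. by []. Qed.

Lemma cliques_ge0 k X : 0 <= cliques k X.
Proof. by elim: k X => [|k IH] X /=; rewrite ?ler01 ?sumr_ge0. Qed.

Lemma sumr1_card X : \sum_(x in X) (1 : R) = #|X|%:R.
Proof. by rewrite sumr_const. Qed.

Lemma sum_le_card X (f : T -> R) b :
  (forall x, x \in X -> f x <= b) -> \sum_(x in X) f x <= #|X|%:R * b.
Proof. by move=> fb; rewrite mulr_natl -sumr_const ler_sum. Qed.

Lemma cliques_le k X : cliques k X <= #|T|%:R ^+ k.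
Proof.
elim: k X => [|k IH] X //=; apply: le_trans (sum_le_card (fun x _ => IH _)) _.
by rewrite exprS ler_wpM2r ?exprn_ge0 // ler_nat max_card.
Qed.

Definition npairs P X Y : R := \sum_(x in X) \sum_(y in Y) (P x y)%:R.

Lemma npairs_ge0 P X Y : 0 <= npairs P X Y.
Proof. by rewrite sumr_ge0 // => x _; rewrite sumr_ge0. Qed.

Lemma npairs_le P X Y : npairs P X Y <= #|X|%:R * #|Y|%:R.
Proof.
by apply: sum_le_card => x _; rewrite -sumr1_card ler_sum // => y _; case: P.
Qed.

Lemma npairsT P X Y :
  (forall x y, x \in X -> y \in Y -> P x y) -> npairs P X Y = #|X|%:R * #|Y|%:R.
Proof.
move=> XY; rewrite mulr_natl -sumr_const; apply: eq_bigr => x xX.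
by rewrite -sumr1_card; apply: eq_bigr => y yY; rewrite XY.
Qed.

Lemma npairs0 P X Y :
  (forall x y, x \in X -> y \in Y -> ~~ P x y) -> npairs P X Y = 0.
Proof.
by move=> XY; apply: big1 => x xX; apply: big1 => y yY; rewrite (negbTE (XY _ _ _ _)).
Qed.

Lemma eq_npairs P P' X Y :
  (forall x y, x \in X -> y \in Y -> P x y = P' x y) -> npairs P X Y = npairs P' X Y.
Proof. by move=> XY; apply: eq_bigr => x xX; apply: eq_bigr => y yY; rewrite XY. Qed.

Lemma npairs_sym P X Y : symmetric P -> npairs P X Y = npairs P Y X.
Proof.
move=> sP; rewrite /npairs exchange_big; apply: eq_bigr => y _.
by apply: eq_bigr => x _; rewrite sP.
Qed.

Lemma npairsl P A X Y : A \subset X ->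
  npairs P X Y = npairs P A Y + npairs P (X :\: A) Y.
Proof. by move=> AX; rewrite /npairs (big_setID A) (setIidPr AX). Qed.

Lemma npairsr P A X Y : A \subset Y ->
  npairs P X Y = npairs P X A + npairs P X (Y :\: A).
Proof.
move=> AY; rewrite /npairs -big_split; apply: eq_bigr => x _.
by rewrite (big_setID A) (setIidPr AY).
Qed.

Lemma npairs_split P A X : symmetric P -> A \subset X ->
  npairs P X X = npairs P A A + 2 * npairs P A (X :\: A) + npairs P (X :\: A) (X :\: A).
Proof.
move=> sP AX; rewrite (npairsl _ _ AX) !(npairsr _ _ AX).
by rewrite (@npairs_sym P (X :\: A) A) //; ring.
Qed.

End Cliques.

(* Furedi's argument: the non-neighbours of a vertex of maximum degree form a part,
   and one recurses in its neighbourhood; the few vertices lying in many cliques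
   are excluded from the choice. *)
Lemma few_cliques_partition (R : realFieldType) (r : nat) (g : R) : 0 < g ->
  exists2 eps : R, 0 < eps & forall (T : finType) (e : rel T) (X : {set T}),
    symmetric e -> cliques R e r.+2 X <= eps * #|T|%:R ^+ r.+2 ->
  exists2 c : T -> nat, (forall x, (c x <= r)%N) &
    npairs R (fun x y => e x y && (c x == c y)) X X + npairs R e X X <=
    npairs R (fun x y => c x != c y) X X + g * #|T|%:R ^+ 2.
Proof.
elim: r g => [|r IH] g g0.
  exists (g / 2) => [|T e X se]; first by rewrite divr_gt0.
  have -> : cliques R e 2 X = npairs R e X X.
    rewrite /npairs /=; apply: eq_bigr => x _; rewrite sumr1_card -sumr1_card.
    rewrite big_mkcond [RHS]big_mkcond /=; apply: eq_bigr => y _.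
    by rewrite !inE; case: (y \in X); case: (e x y).
  move=> eX; exists (fun=> 0%N) => //.
  rewrite (@eq_npairs _ _ _ e) => [|x y _ _]; last by rewrite eqxx andbT.
  by have := @npairs_ge0 R T (fun x y => 0%N != 0%N) X X; lra.
have [|eps eps0 IHe] := IH (g / 2); first by rewrite divr_gt0.
(* With this constant at most g n / 4 vertices have more than eps n^(r+2) cliques in their
   neighbourhood. *)
exists (eps * (g / 4)) => [|T e X se]; first by rewrite mulr_gt0 // divr_gt0.
have [T0 _|Tpos cX] := posnP #|T|.
  have X0 : X = set0 by apply/eqP; rewrite -cards_eq0 -leqn0 -T0 max_card.
  exists (fun=> 0%N) => //; rewrite X0 /npairs !big_set0 T0 expr0n /= mulr0; lra.
have nT : 0 < #|T|%:R :> R by rewrite ltr0n.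
set n : R := #|T|%:R in nT cX *.
pose d x := X :&: nbrs e x.
pose Z := [set x in X | eps * n ^+ r.+2 < cliques R e r.+2 (d x)].
have ZX : Z \subset X by apply/subsetP => x; rewrite inE => /andP[].
have Zn : #|Z|%:R <= g / 4 * n.
  have n0 : 0 < eps * n ^+ r.+2 by rewrite mulr_gt0 ?exprn_gt0.
  rewrite -(ler_pM2r n0); apply: (@le_trans _ _ (cliques R e r.+3 X)).
    rewrite cliquesS (big_setID Z) (setIidPr ZX) -[leLHS]addr0 lerD //; last first.
      by rewrite sumr_ge0 // => x _; exact: cliques_ge0.
    rewrite mulr_natl -sumr_const; apply: ler_sum => x.
    by rewrite inE => /andP[_ /ltW].
  by apply: le_trans cX _; rewrite le_eqVlt; apply/orP; left; apply/eqP; rewrite exprS; ring.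
have Zn2 : #|Z|%:R * n <= g / 4 * n ^+ 2.
  by rewrite expr2 mulrA ler_wpM2r // ltW.
have Xle (Y : {set T}) : #|Y|%:R <= n by rewrite ler_nat max_card.
have [XZ|[x1 x1X]] := set_0Vmem (X :\: Z).
  have XeqZ : X = Z by apply/eqP; rewrite eqEsubset ZX andbT -setD_eq0 XZ.
  exists (fun=> 0%N) => //.
  rewrite (@eq_npairs _ _ _ e) => [|x y _ _]; last by rewrite eqxx andbT.
  have : npairs R e X X <= #|Z|%:R * n.
    by rewrite XeqZ (le_trans (npairs_le _ _ _ _)) // ler_wpM2l.
  have : 0 <= g * n ^+ 2 by rewrite mulr_ge0 ?sqr_ge0 // ltW.
  by have := @npairs_ge0 R T (fun x y => 0%N != 0%N) X X; lra.
case: (@arg_maxnP _ x1 (mem (X :\: Z)) (fun x => #|d x|) x1X) => x0 x0X dmax.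
have [x0Z cx0] : x0 \in X /\ cliques R e r.+2 (d x0) <= eps * n ^+ r.+2.
  by move: x0X; rewrite !inE => /andP[nZ xX]; move: nZ; rewrite xX /= -leNgt.
have AX : d x0 \subset X by rewrite subsetIl.
set A := d x0 in cx0 AX dmax.
have [c cr cA] := IHe T e A se cx0.
pose c' x := if x \in A then c x else r.+1.
exists c' => [x|].
  by rewrite /c'; case: ifP => // _; rewrite (leq_trans (cr x)).
set B := X :\: A.
have Bdeg : npairs R e B X <= #|B|%:R * #|A|%:R + #|Z|%:R * n.
  rewrite /npairs (bigID (mem Z)) /= addrC.
  have degE x : \sum_(y in X) (e x y)%:R = #|d x|%:R :> R.
    rewrite -sumr1_card big_mkcond [RHS]big_mkcond /=; apply: eq_bigr => y _.
    by rewrite !inE; case: (y \in X); case: (e x y).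
  rewrite lerD //.
    rewrite (eq_bigl (mem (B :\: Z))) => [|x]; last by rewrite !inE andbC.
    apply: (@le_trans _ _ (#|B :\: Z|%:R * #|A|%:R)).
      apply: sum_le_card => x; rewrite !inE => /and3P[xZ _ xX].
      by rewrite degE ler_nat; apply: dmax; rewrite !inE xX andbT in xZ *.
    by rewrite ler_wpM2r // ler_nat subset_leq_card // subsetDl.
  rewrite (eq_bigl (mem (B :&: Z))) => [|x]; last by rewrite !inE.
  apply: (@le_trans _ _ (#|B :&: Z|%:R * n)).
    by apply: sum_le_card => x _; rewrite degE.
  by rewrite ler_wpM2r ?ler_nat ?subset_leq_card ?subsetIr // ltW.
have eX := npairs_split R se AX.
move: Bdeg; rewrite (npairsr _ _ _ AX) -/B (npairs_sym _ _ _ se).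
have c'A x : x \in A -> c' x = c x by rewrite /c' => ->.
have c'B x : x \in B -> c' x = r.+1 by rewrite /c' inE; case: (x \in A).
have c'r x : x \in A -> c' x != r.+1 by move=> xA; rewrite c'A // neq_ltn ltnS cr.
have -> : npairs R (fun x y => e x y && (c' x == c' y)) X X =
    npairs R (fun x y => e x y && (c x == c y)) A A + npairs R e B B.
  rewrite (npairs_split _ _ AX) -/B => [|x y]; last by rewrite se eq_sym.
  rewrite (@npairs0 _ _ _ A B) => [|x y xA yB]; last first.
    by rewrite (c'B y yB) (negbTE (c'r x xA)) andbF.
  rewrite mulr0 addr0; congr (_ + _); apply: eq_npairs => x y.
    by move=> xA yA; rewrite !c'A.
  by move=> xB yB; rewrite !c'B // eqxx andbT.
have -> : npairs R (fun x y => c' x != c' y) X X =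
    npairs R (fun x y => c x != c y) A A + 2 * (#|A|%:R * #|B|%:R).
  rewrite (npairs_split _ _ AX) -/B => [|x y]; last by rewrite eq_sym.
  rewrite (@npairsT _ _ _ A B) => [|x y xA yB]; last by rewrite (c'B y yB) c'r.
  rewrite (@npairs0 _ _ _ B B) => [|x y xB yB]; last by rewrite !c'B // eqxx.
  rewrite addr0; congr (_ + _); apply: eq_npairs => x y xA yA.
  by rewrite !c'A.
(* Pairs inside [B] count both as monochromatic pairs and as edges, so the left side grows by twice
   [npairs R e B X]. As [x0] has maximum degree, this is at most 2 |A| |B| + 2 |Z| n, and 2 |A| |B|
   is what the right side gains. *)
by move: cA eX Zn2; rewrite -/n; lra.
Qed.

(** * Supersaturation: from many cliques to many blow-ups *)

Section CliqueSum.
Variables (R : realFieldType) (T : finType) (e : rel T).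
Implicit Types (X Y : {set T}) (f g : {set T} -> R).

(* The sum of [f (Y :&: common neighbourhood)] over the ordered [k]-cliques of [X]. *)
Fixpoint clique_sum k X Y f : R :=
  if k is k'.+1 then
    \sum_(x in X) clique_sum k' (X :&: nbrs e x) (Y :&: nbrs e x) f
  else f Y.

Lemma clique_sum_card k X :
  clique_sum k X X (fun Y => #|Y|%:R) = cliques R e k.+1 X.
Proof.
elim: k X => [|k IH] X; first by rewrite cliquesS sumr1_card.
by rewrite cliquesS; apply: eq_bigr => x _; exact: IH.
Qed.

Lemma clique_sum_le k X Y f g : (forall Z, f Z <= g Z) ->
  clique_sum k X Y f <= clique_sum k X Y g.
Proof.
by move=> fg; elim: k X Y => //= k IH X Y; apply: ler_sum => x _.
Qed.

Lemma clique_sum_lin k X Y a b f :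
  clique_sum k X Y (fun Z => a * f Z - b) = a * clique_sum k X Y f - b * cliques R e k X.
Proof.
elim: k X Y => [|k IH] X Y /=; first by rewrite mulr1.
by under eq_bigr do rewrite IH; rewrite sumrB !mulr_sumr.
Qed.

Lemma clique_sumZ k X Y a f :
  clique_sum k X Y (fun Z => a * f Z) = a * clique_sum k X Y f.
Proof.
by elim: k X Y => //= k IH X Y; under eq_bigr do rewrite IH; rewrite mulr_sumr.
Qed.

Variable V : finType.
Implicit Type F : {ffun V -> T}.

Definition common_nbrs (P : pred V) F : {set T} := [set y | [forall u, P u ==> e (F u) y]].

(** Double counting of pairs of a map [F] and an ordered clique adjacent to all its values: a clique
    with common neighbourhood [Z] inside [Y] admits [#|Z| ^ #|V|] maps. *)
Lemma sum_common_nbrs k X Y : symmetric e ->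
  \sum_(F : {ffun V -> T} | [forall u, F u \in Y])
     cliques R e k (X :&: common_nbrs xpredT F) =
  clique_sum k X Y (fun Z => #|Z|%:R ^+ #|V|).
Proof.
move=> se; elim: k X Y => [|k IH] X Y /=.
  rewrite sumr_const -natrX -card_ffun_on; congr _%:R.
rewrite (eq_bigr (fun F : {ffun V -> T} => \sum_(x in X) if x \in common_nbrs xpredT F then
   cliques R e k (X :&: nbrs e x :&: common_nbrs xpredT F) else 0)) => [|F _]; last first.
  rewrite big_mkcond [RHS]big_mkcond; apply: eq_bigr => x _.
  by rewrite !inE; case: (x \in X) => //=; case: ifP => // _; rewrite setIAC.
rewrite exchange_big; apply: eq_bigr => x _ /=; rewrite -IH -big_mkcondr.
apply: eq_bigl => F; apply/andP/forallP => [[/forallP FY]|FYx].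
  by rewrite inE => /forallP Fx u; rewrite !inE FY se; exact: (Fx u).
split; first by apply/forallP => u; have := FYx u; rewrite inE => /andP[].
by rewrite inE; apply/forallP => u; have := FYx u; rewrite !inE se => /andP[].
Qed.

(** Convexity is replaced by the linear bound a (z - h) <= n z^s for 0 <= z <= n, where h = eps n /
    2 and a = h^s. Summed over the [k]-cliques, the subtracted term costs at most half of the
    assumed number of [k.+1]-cliques. *)
Lemma sum_common_nbrs_ge k X eps : symmetric e -> 0 < eps -> (0 < #|T|)%N ->
  eps * #|T|%:R ^+ k.+1 <= cliques R e k.+1 X ->
  (eps / 2) ^+ #|V|.+1 * #|T|%:R ^+ (#|V| + k) <=
   \sum_(F : {ffun V -> T} | [forall u, F u \in X])
     cliques R e k (X :&: common_nbrs xpredT F).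
Proof.
move=> se eps0 T0; rewrite -clique_sum_card sum_common_nbrs //.
have n0 : 0 < #|T|%:R :> R by rewrite ltr0n.
set n : R := #|T|%:R in n0 *; set s := #|V| => cX.
pose a := (eps / 2) ^+ s * n ^+ s.
have h0 : 0 <= eps / 2 by rewrite divr_ge0 // ltW.
have hn : 0 <= eps / 2 * n := mulr_ge0 h0 (ltW n0).
have a0 : 0 <= a by rewrite mulr_ge0 ?exprn_ge0 // ltW.
have pw (Z : {set T}) : a * #|Z|%:R - a * (eps / 2 * n) <= n * #|Z|%:R ^+ s.
  rewrite -mulrBr; have [Zle|/ltW Zge] := leP #|Z|%:R (eps / 2 * n).
    apply: (@le_trans _ _ 0); first by rewrite mulr_ge0_le0 // subr_le0.
    by rewrite mulr_ge0 ?exprn_ge0 // ltW.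
  rewrite mulrC; apply: ler_pM => //; first by rewrite subr_ge0.
    by rewrite lerBlDr ler_wpDr ?ler_nat ?max_card // mulr_ge0 //.
  by rewrite /a -exprMn lerXn2r ?nnegrE.
have := clique_sum_le k X X pw; rewrite clique_sum_lin clique_sumZ => sumle.
rewrite -(ler_pM2l n0); apply: le_trans sumle.
have cle : a * (eps / 2 * n) * cliques R e k X <= a * (eps / 2 * n) * n ^+ k.
  by apply: ler_wpM2l (mulr_ge0 a0 hn) _ _ _; exact: cliques_le.
have := ler_wpM2l a0 cX.
have -> : n * ((eps / 2) ^+ s.+1 * n ^+ (s + k)) = a * (eps / 2 * n) * n ^+ k.
  by rewrite /a exprS exprD; ring.
have -> : a * (eps * n ^+ k.+1) = 2 * (a * (eps / 2 * n) * n ^+ k).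
  by rewrite exprS; field.
by move: cle; lra.
Qed.

End CliqueSum.

(** A reverse Markov inequality: the terms below [a * b] make up at most half of the sum, and the
    others are at most [b] each. *)
Lemma markov_card (R : realFieldType) (I : finType) (P : pred I) (f : I -> R) (a b : R) :
  0 <= a -> 0 < b -> (forall i, P i -> f i <= b) ->
  2 * a * b * #|I|%:R <= \sum_(i | P i) f i ->
  a * #|I|%:R <= #|[set i | P i & a * b <= f i]|%:R.
Proof.
move=> a0 b0 fb sumf; set J := [set i | _].
suff sumle : \sum_(i | P i) f i <= #|J|%:R * b + a * b * #|I|%:R.
  by rewrite -(ler_pM2r b0); move: (le_trans sumf sumle); lra.
rewrite (bigID (mem J)) /= lerD //.
  rewrite (eq_bigl (mem J)) => [|i]; last by rewrite !inE andbA andbb.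
  by apply: sum_le_card => i; rewrite inE => /andP[/fb].
apply: (@le_trans _ _ (\sum_(i | P i && (i \notin J)) a * b)).
  by apply: ler_sum => i /andP[Pi]; rewrite inE Pi /= -ltNge => /ltW.
rewrite big_mkcond /= [leRHS]mulrC mulr_natl -sumr_const; apply: ler_sum => i _.
by case: ifP => // _; rewrite mulr_ge0 // ltW.
Qed.

Section Blowup.
Variables (R : realFieldType) (V : finType) (c : V -> nat).

(* Only the vertices of colour less than [k] are constrained, so that [phi] stays a
   function on the whole of [V]. *)
Definition blowup (T : finType) (e : rel T) k (X : {set T}) : {set {ffun V -> T}} :=
  [set phi : {ffun V -> T} | [forall u, (c u < k)%N ==> (phi u \in X)] &
    [forall u, forall v, [&& (c u < k)%N, (c v < k)%N & c u != c v] ==> e (phi u) (phi v)]].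

Lemma blowup_merge (T : finType) (e : rel T) k (X : {set T}) (F phi : {ffun V -> T}) :
  symmetric e -> (forall u, F u \in X) ->
  phi \in blowup e k (X :&: common_nbrs e xpredT F) ->
  [ffun u => if c u == k then F u else phi u] \in blowup e k.+1 X.
Proof.
move=> se FX; rewrite !inE => /andP[/forallP phiX /forallP phie].
apply/andP; split.
  apply/forallP => u; apply/implyP; rewrite ffunE ltnS leq_eqVlt.
  by case: eqP => //= _ cu; have := phiX u; rewrite cu inE=> /andP[].
have phiF u v : (c v < k)%N -> e (F u) (phi v).
  move=> cv; have := phiX v; rewrite cv !inE => /andP[_ /forallP]; exact.
apply/forallP => u; apply/forallP => v; apply/implyP => /and3P[].
have ltS x : (x < k.+1)%N = (x == k) || (x < k)%N by rewrite ltnS leq_eqVlt.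
rewrite !ffunE !ltS.
case: eqP => [->|_] /=; case: eqP => [->|_] //=; rewrite ?eqxx //.
- by move=> _ cv _; apply: phiF.
- by move=> cu _ _; rewrite se; apply: phiF.
by move=> cu cv cuv; have /forallP/(_ v) := phie u; rewrite cu cv cuv.
Qed.

(** Many maps [F] have many [k]-cliques in their common neighbourhood, and inside it the induction
    hypothesis gives many maps [phi]. Colour class [k] takes its values from [F], the smaller
    colours from [phi]. *)
Lemma blowup_card (k : nat) (eps : R) : 0 < eps ->
  exists2 eps' : R, 0 < eps' & forall (T : finType) (e : rel T) (X : {set T}),
    symmetric e -> (0 < #|T|)%N -> eps * #|T|%:R ^+ k <= cliques R e k X ->
  eps' * #|T|%:R ^+ #|V| <= #|blowup e k X|%:R.
Proof.
elim: k eps => [|k IH] eps eps0.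
  exists 1 => // T e X se T0 _; rewrite mul1r -natrX -card_ffun ler_nat.
  apply: subset_leq_card; apply/subsetP => phi _; rewrite inE.
  by apply/andP; split; apply/forallP => u; rewrite ?ltn0 //; apply/forallP.
pose a := (eps / 2) ^+ #|V|.+1 / 2.
have a0 : 0 < a by rewrite divr_gt0 // exprn_gt0 // divr_gt0.
have [b b0 IHb] := IH a a0.
exists (a * b) => [|T e X se T0 cX]; first by rewrite mulr_gt0.
have n0 : 0 < #|T|%:R :> R by rewrite ltr0n.
set n : R := #|T|%:R in n0 *.
have cF : #|{ffun V -> T}|%:R = n ^+ #|V| :> R by rewrite card_ffun natrX.
have := @markov_card R _ (fun F : {ffun V -> T} => [forall u, F u \in X])
  (fun F => cliques R e k (X :&: common_nbrs e xpredT F)) a (n ^+ k) (ltW a0)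
  (exprn_gt0 _ n0) (fun _ _ => cliques_le _ _ _ _).
rewrite cF; set J := [set F | _ & _] => /(_ _)/= J1.
have {}J1 : a * n ^+ #|V| <= #|J|%:R.
  apply: J1; apply: le_trans (sum_common_nbrs_ge V se eps0 T0 cX).
  by rewrite /a exprD le_eqVlt; apply/orP; left; apply/eqP; field.
have nV : 0 < n ^+ #|V| by rewrite exprn_gt0.
rewrite -(ler_pM2r nV) -[X in _ <= _ * X]cF -natrM.
pose merge (F phi : {ffun V -> T}) := [ffun u => if c u == k then F u else phi u].
(* The merge forgets values of both maps. Storing these in a second map makes it an involution; the
   factor [n ^+ #|V|] for the second map is matched on the other side by counting pairs. *)
pose pr (q : {ffun V -> T} * {ffun V -> T}) := (merge q.1 q.2, merge q.2 q.1).
have prK : involutive pr.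
  by case=> F phi; congr pair; apply/ffunP => u; rewrite !ffunE; case: eqP.
pose G := [set q : {ffun V -> T} * {ffun V -> T} | (q.1 \in J) &
  (q.2 \in blowup e k (X :&: common_nbrs e xpredT q.1))].
have sG : pr @: G \subset setX (blowup e k.+1 X) setT.
  apply/subsetP => q /imsetP[[F phi]]; rewrite !inE /= => /andP[/andP[/forallP FX _]].
  move=> phiF ->; rewrite /= andbT; have := @blowup_merge T e k X F phi se FX.
  by rewrite !inE; apply.
have := subset_leq_card sG; rewrite card_imset; last exact: inv_inj prK.
rewrite cardsX cardsT -(ler_nat R); apply: le_trans.
have -> : #|G|%:R = \sum_(F in J) #|blowup e k (X :&: common_nbrs e xpredT F)|%:R :> R.
  rewrite -sum1_card (eq_bigl (fun q => (q.1 \in J) &&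
    (q.2 \in blowup e k (X :&: common_nbrs e xpredT q.1)))) => [|q]; last by rewrite inE.
  rewrite -(pair_big_dep (mem J)
    (fun F phi => phi \in blowup e k (X :&: common_nbrs e xpredT F)) (fun _ _ => 1%N)).
  rewrite /= natr_sum.
  by apply: eq_bigr => F _; rewrite sum1_card.
apply: (@le_trans _ _ (\sum_(F in J) b * n ^+ #|V|)).
  rewrite sumr_const -[leRHS]mulr_natl.
  have : a * n ^+ #|V| * (b * n ^+ #|V|) <= #|J|%:R * (b * n ^+ #|V|).
    by rewrite ler_wpM2r // ltW // mulr_gt0.
  by rewrite !mulrA (mulrAC a).
apply: ler_sum => F; rewrite inE => /andP[_]; exact: IHb.
Qed.

End Blowup.

(** * Ordered pairs and colour classes *)

Section PairCounts.
Variables (R : realFieldType) (T : finType).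

Lemma card_ordered_pairs (d : {set T}) : #|d| = 2 ->
  #|[set q : T * T | [set q.1; q.2] == d]| = 2%N.
Proof.
move/eqP/cards2P => [a [b [ab ->]]].
rewrite (_ : [set q | _] = [set (a, b); (b, a)]); last first.
  apply/setP => -[x y]; rewrite !inE /= !xpair_eqE.
  apply/eqP/orP => [E|[]/andP[/eqP-> /eqP->]//]; last exact: setUC.
  have xy : x != y by have := cards2 x y; rewrite E cards2 ab; case: eqP.
  have : x \in [set a; b] by rewrite -E set21.
  have : y \in [set a; b] by rewrite -E set22.
  move: xy; rewrite !inE => /[swap] /orP[]/eqP-> /[swap] /orP[]/eqP->;
    rewrite ?eqxx // => _; by [right | left].
rewrite cards2; congr _.+1; apply/eqP; rewrite eqb1.
by apply: contra_neq ab => -[].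
Qed.

Lemma npairs_edges (D : {set {set T}}) : {in D, forall d : {set T}, #|d| = 2%N} ->
  npairs R (fun x y => [set x; y] \in D) setT setT = 2 * #|D|%:R.
Proof.
move=> D2; rewrite /npairs.
rewrite (eq_bigl xpredT) => [|x]; last by rewrite inE.
under eq_bigr do under eq_bigl do rewrite inE.
rewrite pair_bigA /= -natr_sum -natrM; congr _%:R.
rewrite -big_mkcond /= sum1_card.
rewrite -sum1_card (partition_big (fun q : T * T => [set q.1; q.2]) (mem D)) => [|q]; last first.
  by rewrite unfold_in.
rewrite mulnC -sum_nat_const; apply: eq_bigr => d dD.
rewrite sum1_card -(card_ordered_pairs (D2 d dD)); apply: eq_card => q.
rewrite [RHS]inE unfold_in; apply: andb_idl => /eqP qd; rewrite unfold_in qd; exact: dD.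
Qed.

Lemma npairs_eq_ge k (c : T -> 'I_k.+1) :
  #|T|%:R ^+ 2 / k.+1%:R <= npairs R (fun x y => c x == c y) setT setT.
Proof.
pose a i := #|[set x | c x == i]|.
have -> : npairs R (fun x y => c x == c y) setT setT = \sum_i (a i)%:R ^+ 2.
  rewrite /npairs (partition_big c xpredT) //=; apply: eq_bigr => i _.
  rewrite expr2 mulr_natl -sumr_const; apply: eq_big => [x|x /andP[_ /eqP <-]].
    by rewrite !inE.
  rewrite -natr_sum; congr _%:R; rewrite -big_mkcondr /= sum1_card.
  by apply: eq_card => y; rewrite !inE unfold_in /= inE eq_sym.
have sa : \sum_i (a i)%:R = #|T|%:R :> R.
  rewrite -natr_sum; congr _%:R; rewrite -sum1_card (partition_big c xpredT) //=.
  by apply: eq_bigr => i _; rewrite sum1_card; apply: eq_card => x; rewrite !inE.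
have k0 : 0 < k.+1%:R :> R by [].
rewrite ler_pdivrMr //.
have : 0 <= \sum_i (k.+1%:R * (a i)%:R - #|T|%:R) ^+ 2 :> R.
  by apply: sumr_ge0 => i _; rewrite sqr_ge0.
have -> : \sum_i (k.+1%:R * (a i)%:R - #|T|%:R) ^+ 2 =
    k.+1%:R * (k.+1%:R * (\sum_i (a i)%:R ^+ 2) - #|T|%:R ^+ 2) :> R.
  have E i : (k.+1%:R * (a i)%:R - #|T|%:R) ^+ 2 = k.+1%:R ^+ 2 * (a i)%:R ^+ 2
      + (- 2 * k.+1%:R * #|T|%:R) * (a i)%:R + #|T|%:R ^+ 2 :> R by ring.
  under eq_bigr do rewrite E.
  rewrite !big_split /= -!mulr_sumr sa sumr_const card_ord -[_ *+ k.+1]mulr_natl.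
  by ring.
by rewrite pmulr_rge0 // subr_ge0 mulrC.
Qed.

Lemma npairs_neq k (c : T -> 'I_k.+1) :
  npairs R (fun x y => c x != c y) setT setT =
  #|T|%:R ^+ 2 - npairs R (fun x y => c x == c y) setT setT.
Proof.
apply/eqP; rewrite eq_sym subr_eq -big_split /= expr2 -cardsT mulr_natl -sumr_const.
apply/eqP; apply: eq_bigr => x _; rewrite -big_split /= -sumr1_card; apply: eq_bigr => y _.
by case: (c x == c y); rewrite ?add0r ?addr0.
Qed.

End PairCounts.

(** * Labelled copies of H and stability *)

Section Copies.
Variables (V T : finType) (H : sgraph V).

Definition copies (A : {set {set T}}) : {set {ffun V -> T}} :=
  [set phi : {ffun V -> T} |
    injectiveb phi & [forall e in edges H, phi @: (e : {set V}) \in A]].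

Definition mono (C : eqType) (c : T -> C) : {set {set T}} :=
  [set a : {set T} | [forall x in a, forall y in a, c x == c y]].

Lemma mono2 (C : eqType) (c : T -> C) x y : ([set x; y] \in mono c) = (c x == c y).
Proof.
rewrite inE; apply/forall_inP/eqP => [/(_ x)|xy z].
  by rewrite !inE eqxx => /(_ isT)/forall_inP/(_ y); rewrite !inE eqxx orbT => /(_ isT)/eqP.
rewrite !inE => /orP[]/eqP->; apply/forall_inP => t; rewrite !inE => /orP[]/eqP->;
  by rewrite ?xy.
Qed.

(** Overwriting the value at [v] is injective on these maps, since the old value survives at [u]. *)
Lemma card_ffun_collision (u v : V) : u != v ->
  (#|T| * #|[set phi : {ffun V -> T} | phi u == phi v]| <= #|T| ^ #|V|)%N.
Proof.
move=> uv; pose P := [set phi : {ffun V -> T} | phi u == phi v].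
pose upd (q : T * {ffun V -> T}) := [ffun z => if z == v then q.1 else q.2 z].
rewrite -card_ffun -cardsT -cardsX.
rewrite -(card_in_imset (f := upd)) ?max_card // => -[x phi] [y psi].
rewrite !inE /= => /eqP phiuv /eqP psiuv /ffunP E; congr pair.
  by have := E v; rewrite !ffunE eqxx.
have Eu : phi u = psi u by have := E u; rewrite !ffunE (negbTE uv).
apply/ffunP => z; have := E z; rewrite !ffunE.
by case: eqVneq => // -> _; rewrite -phiuv -psiuv.
Qed.

(** Blow-ups only give homomorphisms. The non-injective maps are a fraction of at most |V|^2 / n, so
    for large n most of these homomorphisms are copies. *)
Lemma card_noninjective :
  (#|T| * #|[set phi : {ffun V -> T} | ~~ injectiveb phi]| <= #|V| ^ 2 * #|T| ^ #|V|)%N.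
Proof.
set J := [set phi | _].
have sub : J \subset
    \bigcup_(q : V * V | q.1 != q.2) [set phi : {ffun V -> T} | phi q.1 == phi q.2].
  apply/subsetP => phi; rewrite inE => /injectivePn[x [y xy Exy]].
  by apply/bigcupP; exists (x, y); rewrite ?inE ?Exy.
apply: (@leq_trans (#|T| *
  \sum_(q : V * V | q.1 != q.2) #|[set phi : {ffun V -> T} | phi q.1 == phi q.2]|)).
  by rewrite leq_mul2l (leq_trans (subset_leq_card sub)) ?orbT ?card_bigcup_le.
rewrite big_distrr /=.
apply: (@leq_trans (\sum_(q : V * V | q.1 != q.2) #|T| ^ #|V|)).
  by apply: leq_sum => q /card_ffun_collision.
rewrite sum_nat_const leq_mul2r; apply/orP; right.
by rewrite -mulnn -card_prod max_card.
Qed.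

End Copies.

(** Here [r] is one less than in the overview: there are [r.+1] colours. An [r.+2]-colouring of H
    makes every blow-up of K_(r+2) in [A] a homomorphism of H, so few copies exclude many cliques.
    The partition lemma counts pairs in both orders, hence its error [2 * g]. *)
Lemma stability (R : realType) (V : finType) (H : sgraph V) (r : nat) (g : R) :
  kpartite r.+2 H -> 0 < g ->
  exists2 eps : R, 0 < eps & exists n1 : nat, forall (T : finType) (A : {set {set T}}),
    (n1 <= #|T|)%N -> {in A, forall a : {set T}, #|a| = 2%N} ->
    #|copies H A|%:R < eps * #|T|%:R ^+ #|V| ->
  exists c : T -> 'I_r.+1,
    #|A|%:R + #|A :&: mono c|%:R <=
      (1 - r.+1%:R^-1) * (#|T|%:R ^+ 2 / 2) + g * #|T|%:R ^+ 2.
Proof.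
move=> /existsP[col colP] g0.
have g20 : 0 < 2 * g by rewrite mulr_gt0.
have [eps1 eps10 part] := few_cliques_partition r g20.
have [eps2 eps20 blow] := blowup_card (fun u => col u : nat) r.+2 eps10.
exists (eps2 / 2); first by rewrite divr_gt0.
(* Above this size the non-injective maps are at most half of [eps2 * n ^ #|V|]. *)
have [n1 n1P] : exists n1 : nat, 2 * #|V|%:R ^+ 2 / eps2 < n1%:R.
  have v0 : 0 <= 2 * #|V|%:R ^+ 2 / eps2 :> R.
    by rewrite divr_ge0 ?mulr_ge0 ?exprn_ge0 // ltW.
  by exists (Num.bound (2 * #|V|%:R ^+ 2 / eps2)); apply: archi_boundP.
exists n1.+1 => T A Tn A2 few.
have T0 : (0 < #|T|)%N by exact: leq_ltn_trans Tn.
have n0 : 0 < #|T|%:R :> R by rewrite ltr0n.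
pose e : rel T := fun x y => [set x; y] \in A.
have se : symmetric e by move=> x y; rewrite /e setUC.
have [many|cl] := leP (eps1 * #|T|%:R ^+ r.+2) (cliques R e r.+2 setT).
  set J := [set phi : {ffun V -> T} | ~~ injectiveb phi].
  have blow2 : eps2 * #|T|%:R ^+ #|V| <= #|copies H A|%:R + #|J|%:R.
    apply: le_trans (blow T e setT se T0 many) _; rewrite -natrD ler_nat.
    rewrite -cardsUI (leq_trans _ (leq_addr _ _)) // subset_leq_card //.
    apply/subsetP => phi; rewrite !inE => /andP[_ /forallP phie].
    case: (injectiveb phi) => //=; rewrite orbF; apply/forall_inP => d dH.
    have /cards2P[u [v [uv dE]]] := forall_inP (edgesP H) d dH.
    rewrite dE imsetU !imset_set1; have /forallP/(_ v) := phie u.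
    rewrite !ltn_ord /=; apply/implyP; rewrite implybE.
    have := implyP (forallP (forallP colP u) v); rewrite /adj -dE dH => /(_ isT).
    by move=> -> /=; rewrite orNb.
  have := card_noninjective V T; rewrite -(ler_nat R) !natrM !natrX -/J => J1.
  suff : #|J|%:R <= eps2 / 2 * #|T|%:R ^+ #|V| by move: few blow2; lra.
  rewrite -(ler_pM2l n0) (le_trans J1) // mulrA ler_wpM2r ?exprn_ge0 //.
  rewrite -ler_pdivrMr ?divr_gt0 //; apply: (@le_trans _ _ n1%:R).
    apply: ltW; apply: le_lt_trans n1P.
    by rewrite le_eqVlt; apply/orP; left; apply/eqP; field; rewrite gt_eqF.
  by rewrite ler_nat ltnW.
have [c cr cP] := part T e setT se (ltW cl).
exists (fun x => inord (c x)).
have cE x y : (inord (c x) == inord (c y) :> 'I_r.+1) = (c x == c y).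
  by rewrite -val_eqE /= !inordK // ltnS.
have e1 : npairs R e setT setT = 2 * #|A|%:R by apply: npairs_edges.
set c' := fun x => _.
have e2 : npairs R (fun x y => e x y && (c x == c y)) setT setT =
    2 * #|A :&: mono c'|%:R.
  rewrite -npairs_edges => [|a]; last by rewrite inE => /andP[/A2].
  by apply: eq_npairs => x y _ _; rewrite inE mono2 cE.
have e3 : npairs R (fun x y => c x != c y) setT setT <= #|T|%:R ^+ 2 - #|T|%:R ^+ 2 / r.+1%:R.
  rewrite (@eq_npairs _ _ _ (fun x y => c' x != c' y)) => [|x y _ _]; last by rewrite cE.
  by rewrite npairs_neq lerB // npairs_eq_ge.
by move: cP e3; rewrite e1 e2; move: (npairs _ _ _ _) (r.+1%:R^-1) => u w; lra.
Qed.

(** * The hypergraph of copies of H *)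

Section TwoDensity.
Variables (R : realType) (V : finType) (H : sgraph V).

Lemma edge_card2 d : d \in edges H -> #|d| = 2%N.
Proof. by move/(forall_inP (edgesP H))/eqP. Qed.

Lemma density2_le_m2 K : is_subgraph H K -> (3 <= #|K.1|)%N -> density2 R K <= m2 R H.
Proof. by move=> HK K3; apply: le_bigmax_cond; rewrite HK. Qed.

Lemma adj_sym : symmetric (adj H).
Proof. by move=> x y; rewrite /adj setUC. Qed.

Lemma kpartite_chromatic k : kpartite k H -> (chromatic_number H <= k)%N.
Proof. by rewrite /chromatic_number; case: ex_minnP => j _; apply. Qed.

Lemma chromatic_kpartite : kpartite (chromatic_number H) H.
Proof. by rewrite /chromatic_number; case: ex_minnP. Qed.

Lemma chromatic_cherry : (3 <= chromatic_number H)%N ->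
  exists x y z : V, [/\ y != z, adj H x y & adj H x z].
Proof.
move=> chi; have [//|no] := pselect (exists x y z : V, [/\ y != z, adj H x y & adj H x z]).
suff /kpartite_chromatic : kpartite 2 H by rewrite leqNgt chi.
(* Otherwise H is a matching; colour each edge by the order of its ends. *)
pose lo x := [exists y, adj H x y && (enum_rank y < enum_rank x)%N].
apply/existsP; exists [ffun x => inord (lo x)].
have le12 (b : bool) : (b < 2)%N by case: b.
suff lt_neq x y : adj H x y -> (enum_rank y < enum_rank x)%N -> lo x != lo y.
  apply/forallP => x; apply/forallP => y; apply/implyP => xy; rewrite !ffunE.
  rewrite -val_eqE /= !inordK //.
  have /negP : enum_rank x != enum_rank y.
    by rewrite (inj_eq enum_rank_inj); apply: contraTneq xy => ->; rewrite adj_irrefl.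
  have -> : (lo x == lo y :> nat) = (lo x == lo y) by case: (lo x); case: (lo y).
  case: (ltngtP (enum_rank x) (enum_rank y)) => [xlt|ylt|/val_inj ->]; rewrite ?eqxx //.
    by move=> _; rewrite eq_sym lt_neq // adj_sym.
  by move=> _; rewrite lt_neq.
move=> xy ylt; have -> : lo x = true by apply/existsP; exists y; rewrite xy.
apply/eqP => /esym/existsP[z /andP[yz zlt]]; apply: no; exists y, x, z.
rewrite adj_sym xy yz; split=> //.
by apply: contraTneq zlt => <-; rewrite -leqNgt ltnW.
Qed.

(** A path with two edges has density (2 - 1) / (3 - 2) = 1. The bound makes the exponent 2 - 1/m_2
    at least 1, which later yields m >= n. *)
Lemma m2_ge1 : (3 <= chromatic_number H)%N -> 1 <= m2 R H.
Proof.
case/chromatic_cherry => x [y [z [yz xy xz]]].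
have ne u v : adj H u v -> u != v by apply: contraTneq => ->; rewrite adj_irrefl.
pose K := ([set x; y; z], [set [set x; y]; [set x; z]]).
have K1 : #|K.1| = 3%N.
  by rewrite /= setUC cardsU1 cards2 !inE ne // ![z == _]eq_sym negb_or yz ne.
have K2 : #|K.2| = 2%N.
  rewrite cards2; congr _.+1; apply/eqP; rewrite eqb1; apply/eqP => /setP/(_ y).
  by rewrite !inE eqxx orbT (negbTE yz) orbF eq_sym (negbTE (ne _ _ xy)).
apply: le_trans (density2_le_m2 (K := K) _ _); rewrite ?K1 //.
  by rewrite /density2 K1 K2 ler_pdivlMr; lra.
apply/andP; split.
  by apply/subsetP => d; rewrite !inE => /orP[]/eqP->.
apply/forall_inP => d; rewrite !inE => /orP[]/eqP->; apply/subsetP => t; rewrite !inE.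
  by move=> ->.
by case/orP => ->; rewrite ?orbT.
Qed.

(** If [J] spans only two vertices, it is a single edge and both sides vanish; otherwise [J] with
    its vertices competes in the maximum. *)
Lemma m2_cover (J : {set {set V}}) : 1 <= m2 R H ->
  J \subset edges H -> J != set0 ->
  (2 <= #|cover J|)%N /\ #|J|%:R - 1 <= m2 R H * (#|cover J|%:R - 2).
Proof.
move=> m1 JH /set0Pn[d dJ].
have dc : d \subset cover J by rewrite (bigcup_max d).
have d2 := edge_card2 (subsetP JH d dJ).
have c2 : (2 <= #|cover J|)%N by rewrite -d2 subset_leq_card.
split=> //; move: c2; rewrite leq_eqVlt => /predU1P[c2|c3].
  have Jd : J \subset [set cover J].
    apply/subsetP => b bJ; rewrite inE eqEcard (bigcup_max b) //=.
    by rewrite -c2 (edge_card2 (subsetP JH b bJ)).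
  rewrite -c2 subrr mulr0 subr_le0 (_ : 1 = 1%:R) // ler_nat.
  by rewrite -(cards1 (cover J)) subset_leq_card.
have c0 : 0 < #|cover J|%:R - 2 :> R by rewrite subr_gt0 ltr_nat.
have := @density2_le_m2 (cover J, J) _ c3; rewrite /density2 /= ler_pdivrMr //.
apply; rewrite /is_subgraph /= JH; apply/forall_inP => b bJ.
by rewrite (bigcup_max b).
Qed.

End TwoDensity.

Lemma leq_pow_base (a b k : nat) : (a <= b)%N -> (a ^ k <= b ^ k)%N.
Proof. by case: k => // k ab; rewrite leq_exp2r. Qed.

Lemma card_ffun_into (V T : finType) (U : {set V}) (W : {set T}) :
  #|[set phi : {ffun V -> T} | [forall u in U, phi u \in W]]| =
  (#|W| ^ #|U| * #|T| ^ (#|V| - #|U|))%N.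
Proof.
pose F (u : V) : pred T := fun x => (u \in U) ==> (x \in W).
transitivity #|(family F : simpl_pred {ffun V -> T})|.
  by apply: eq_card => phi; rewrite inE; apply/forall_inP/familyP => phiU u;
    [apply/implyP => /phiU | move/(implyP (phiU u))].
rewrite card_family foldrE big_image /= (bigID (mem U)) /=; congr (_ * _)%N.
  rewrite -prod_nat_const; apply: eq_bigr => u uU.
  by apply: eq_card => x; rewrite unfold_in uU.
rewrite (_ : #|V| - #|U| = #|~: U|)%N; last by rewrite -(cardsC U) addKn.
rewrite -prod_nat_const; apply: eq_big => [u|u uU]; first by rewrite inE.
by apply: eq_card => x; rewrite unfold_in (negbTE uU).
Qed.

Section CopyWeight.
Variables (R : realType) (V T : finType) (H : sgraph V).
Implicit Types (A S : {set {set T}}) (phi : {ffun V -> T}).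

Definition image_edges phi : {set {set T}} := [set phi @: (e : {set V}) | e in edges H].

(** Distinct embeddings may have the same image, so hyperedges carry multiplicities. *)
Definition copy_weight A S : R := #|[set phi in copies H A | image_edges phi == S]|%:R.

Lemma deg_copy_weight A S :
  deg (copy_weight A) S = #|[set phi in copies H A | S \subset image_edges phi]|%:R.
Proof.
rewrite /deg /copy_weight -natr_sum; congr _%:R; rewrite -sum1_card.
rewrite (partition_big image_edges (fun E => S \subset E)) /= => [|phi]; last first.
  by rewrite inE => /andP[].
apply: eq_bigr => E SE; rewrite sum1_card; apply: eq_card => phi.
rewrite inE [RHS]unfold_in inE.
by apply: andb_id2r => /eqP phiE; rewrite !inE phiE SE andbT.
Qed.

Lemma copiesP A phi : phi \in copies H A -> injective phi /\ image_edges phi \subset A.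
Proof.
rewrite inE => /andP[/injectiveP phi_inj /forall_inP phiA]; split=> //.
by apply/subsetP => S /imsetP[e /phiA eA ->].
Qed.

Lemma weighting_copies A : weighting #|edges H| A (copy_weight A).
Proof.
move=> S; split; first exact: ler0n.
rewrite pnatr_eq0 cards_eq0 => /set0Pn[phi]; rewrite inE => /andP[/copiesP[phi_inj phiA] /eqP <-].
by split=> //; rewrite card_imset //; exact: imset_inj.
Qed.

(** An embedding whose edges include [S] maps some set [J] of |S| edges of H onto [S]. There are at
    most 2^e(H) sets [J]; the vertices of [J] go to those of [S] in at most |V|^|V| ways, and the
    others are free. By the definition of m_2, the number |V| - |cover J| of free vertices is at
    most |V| - 2 - (|S| - 1)/m_2. *)
Lemma deg_copy_weight_le A S (b : R) : 1 <= m2 R H -> (0 < #|T|)%N -> S != set0 ->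
  b = #|T|%:R `^ (- (m2 R H)^-1) ->
  deg (copy_weight A) S <=
    (2 ^ #|edges H| * #|V| ^ #|V|)%:R * b ^+ #|S|.-1 * #|T|%:R `^ (#|V|%:R - 2).
Proof.
move=> m1 T0 S0 bE; rewrite deg_copy_weight.
set Q := [set phi in _ | _].
pose P (J : {set {set V}}) := [&& J \subset edges H, #|J| == #|S| & J != set0].
pose QJ (J : {set {set V}}) := [set phi in copies H A | [set phi @: (e : {set V}) | e in J] == S].
have subQ : Q \subset \bigcup_(J | P J) QJ J.
  apply/subsetP => phi; rewrite inE => /andP[phiA Sphi].
  have [phi_inj _] := copiesP phiA.
  pose J := [set e in edges H | phi @: (e : {set V}) \in S].
  have JS : [set phi @: (e : {set V}) | e in J] = S.
    apply/setP => s; apply/imsetP/idP => [[e]|sS].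
      by rewrite inE => /andP[_ eS] ->.
    have /imsetP[e eH sE] := subsetP Sphi s sS.
    by exists e; rewrite // inE eH -sE.
  apply/bigcupP; exists J; last by rewrite inE phiA JS eqxx.
  apply/and3P; split.
  - by apply/subsetP => e; rewrite inE => /andP[].
  - by rewrite -JS card_imset //; exact: imset_inj.
  - by apply: contra_neq S0 => J0; rewrite -JS J0 imset0.
have n1 : 1 <= #|T|%:R :> R by rewrite ler1n.
have b0 : 0 <= b by rewrite bE powR_ge0.
have leJ J : P J -> #|QJ J|%:R <= (#|V| ^ #|V|)%:R * b ^+ #|S|.-1 * #|T|%:R `^ (#|V|%:R - 2).
  case/and3P => JH /eqP JS J0.
  have [c2 cm] := m2_cover m1 JH J0.
  apply: (@le_trans _ _ (#|V| ^ #|V| * #|T| ^ (#|V| - #|cover J|))%:R).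
    rewrite ler_nat; have [->|[phi0]] := set_0Vmem (QJ J); first by rewrite cards0.
    rewrite inE => /andP[_ /eqP phi0S].
    have cS : (#|cover S| <= #|cover J|)%N.
      rewrite -phi0S; suff -> : cover [set phi0 @: (e : {set V}) | e in J] = phi0 @: cover J.
        exact: leq_imset_card.
      rewrite /cover big_imset_idem /=; last exact: setUid.
      by rewrite imset_cover.
    apply: (@leq_trans #|[set phi : {ffun V -> T} | [forall u in cover J, phi u \in cover S]]|).
      apply/subset_leq_card/subsetP => phi; rewrite !inE => /andP[_ /eqP <-].
      apply/forall_inP => u /bigcupP[e eJ ue]; apply/bigcupP.
      by exists (phi @: e); [exact: imset_f | exact: imset_f].
    rewrite card_ffun_into leq_mul2r; apply/orP; right.
    apply: (@leq_trans (#|cover J| ^ #|cover J|)); first exact: leq_pow_base.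
    apply: (@leq_trans (#|V| ^ #|cover J|)).
      by apply: leq_pow_base; exact: max_card.
    rewrite leq_pexp2l ?max_card // (leq_trans _ (max_card (mem (cover J)))) //.
    exact: leq_trans c2.
  rewrite natrM -mulrA ler_wpM2l //.
  rewrite natrX -[leLHS]powR_mulrn // natrB ?max_card //.
  rewrite -[b ^+ _]powR_mulrn // bE -powRrM -powRD; last first.
    by apply/implyP => _; rewrite pnatr_eq0 -lt0n.
  apply: ler_powR => //.
  have S1 : #|S|.-1%:R = #|S|%:R - 1 :> R.
    by rewrite -subn1 natrB // card_gt0.
  rewrite S1 -JS mulNr lerBlDr; have m0 : 0 < m2 R H by exact: lt_le_trans m1.
  suff : (m2 R H)^-1 * (#|J|%:R - 1) <= #|cover J|%:R - 2 by lra.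
  by rewrite mulrC ler_pdivrMr // mulrC.
apply: (@le_trans _ _ (\sum_(J | P J) #|QJ J|%:R)).
  by rewrite -natr_sum ler_nat (leq_trans (subset_leq_card subQ)) ?card_bigcup_le.
apply: le_trans (ler_sum _ leJ) _; rewrite sumr_const natrM -!mulrA -[leLHS]mulr_natl.
rewrite ler_wpM2r ?mulr_ge0 ?exprn_ge0 ?powR_ge0 // ler_nat -card_powerset.
by apply/subset_leq_card/subsetP => J; rewrite unfold_in !inE => /and3P[].
Qed.

End CopyWeight.

Definition pairs (T : finType) : {set {set T}} := [set a : {set T} | #|a| == 2%N].

Lemma card_pairs (T : finType) : #|pairs T| = 'C(#|T|, 2).
Proof. exact: card_draws. Qed.

Lemma card_pairs_le (R : realFieldType) (T : finType) :
  #|pairs T|%:R <= #|T|%:R ^+ 2 / 2 :> R.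
Proof.
rewrite card_pairs ler_pdivlMr // -natrX -natrM ler_nat muln2 bin2.
apply: (@leq_trans (#|T| * #|T|.-1)); first by rewrite -geq_half_double.
by rewrite -mulnn leq_mul2l leq_pred orbT.
Qed.

Lemma powR_unbounded (R : realType) (a x : R) : 0 < a ->
  exists n0 : nat, forall n : nat, (n0 <= n)%N -> x <= n%:R `^ a.
Proof.
move=> a0; have [x0|x0] := leP x 0.
  by exists 0%N => n _; rewrite (le_trans x0) // powR_ge0.
exists (Num.bound (x `^ a^-1)) => n n0.
have xn : x `^ a^-1 <= n%:R.
  by apply: le_trans (ltW (archi_boundP (powR_ge0 _ _))) _; rewrite ler_nat.
have := @ge0_ler_powR R a (ltW a0) (x `^ a^-1) n%:R.
rewrite !nnegrE powR_ge0 ler0n => /(_ isT isT xn).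
by rewrite -powRrM mulVf ?gt_eqF // powRr1 // ltW.
Qed.

(** The scales are N = n^2, tau = eps n^(|V| - 2), so that N tau is the threshold for few copies,
    and p = n^(-1/m_2), so that p N is the fingerprint size up to a factor 2. Each round removes at
    least d N pairs, so [k] rounds with k d >= 1 suffice. *)
Lemma free_coverable (R : realType) (V : finType) (H : sgraph V) (eps : R) :
    (3 <= chromatic_number H)%N -> 0 < eps ->
  exists L n2 : nat, forall T : finType, (n2 <= #|T|)%N ->
  exists2 s0 : nat, s0%:R <= 2 * #|T|%:R `^ (2 - (m2 R H)^-1) &
  forall Good : {set {set T}} -> Prop,
    (forall A : {set {set T}}, A \subset pairs T ->
       #|copies H A|%:R < eps * #|T|%:R ^+ #|V| -> Good A) ->
    coverable s0 Good L (fun I : {set {set T}} => I \subset pairs T /\ copies H I = set0).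
Proof.
move=> chi eps0; have m1 := m2_ge1 R chi.
have m0 : 0 < m2 R H by exact: lt_le_trans m1.
have V3 : (3 <= #|V|)%N.
  rewrite (leq_trans chi) // kpartite_chromatic //.
  apply/existsP; exists [ffun x => enum_rank x].
  apply/forallP => x; apply/forallP => y; apply/implyP => xy; rewrite !ffunE.
  by apply: contraTneq xy => /enum_rank_inj ->; rewrite adj_irrefl.
have V0 : 0 < #|V|%:R :> R by rewrite ltr0n (leq_trans _ V3).
pose K := (2 ^ #|edges H| * #|V| ^ #|V|)%:R / eps.
have K0 : 0 < K.
  by rewrite divr_gt0 // ltr0n muln_gt0 !expn_gt0 /= (leq_trans _ V3).
have [d d0 step] := container_step #|edges H| K0.
have [n2 n2P] := @powR_unbounded R (m2 R H)^-1 d^-1 (eqbRL (invr_gt0 _) m0).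
pose k := Num.bound d^-1; have kd : 1 <= k%:R * d.
  by rewrite -ler_pdivrMr // div1r ltW // archi_boundP // invr_ge0 ltW.
exists (k * #|edges H|)%N, n2.+1 => T Tn.
have T0 : (0 < #|T|)%N by exact: leq_ltn_trans Tn.
have n0 : 0 < #|T|%:R :> R by rewrite ltr0n.
have n1 : 1 <= #|T|%:R :> R by rewrite ler1n.
set n : R := #|T|%:R in n0 n1 *.
pose p := n `^ (- (m2 R H)^-1); pose N := n ^+ 2.
have p0 : 0 < p by exact: powR_gt0.
have pd : p <= d.
  by rewrite /p powRN -(invrK d) lef_pV2 ?posrE ?invr_gt0 ?powR_gt0 // n2P // ltnW.
have N0 : 0 < N by rewrite exprn_gt0.
have pN : p * N = n `^ (2 - (m2 R H)^-1).
  rewrite /N -powR_mulrn ?ler0n // -powRD; first by rewrite addrC.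
  by apply/implyP => _; rewrite gt_eqF.
have pN1 : 1 <= p * N.
  rewrite pN -[leLHS](powRr0 n) ler_powR // subr_ge0.
  by have : (m2 R H)^-1 <= 1; [rewrite invf_le1 | lra].
(* Rounding up stays within 2 p N because p N >= 1. *)
pose s0 := (Num.truncn (p * N)).+1.
have /andP[s0l s0u] : p * N <= s0%:R <= 2 * p * N.
  have := truncn_itv (le_trans ler01 pN1); rewrite -/s0 => /andP[tl /ltW tu].
  rewrite tu /= [leLHS](_ : _ = (Num.truncn (p * N))%:R + 1) ?natr1 //; move: tl pN1; lra.
exists s0; first by rewrite -pN mulrA.
move=> Good HG; pose fam (I : {set {set T}}) := I \subset pairs T /\ copies H I = set0.
pose tau := eps * n `^ (#|V|%:R - 2).
have tau0 : 0 < tau by rewrite mulr_gt0 ?powR_gt0.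
have Ntau : N * tau = eps * n ^+ #|V|.
  rewrite mulrCA -[n ^+ #|V|]powR_mulrn ?ler0n // /N -powR_mulrn ?ler0n // -powRD.
    by congr (_ * _ `^ _); ring.
  by apply/implyP => _; rewrite gt_eqF.
have pairsN : #|pairs T|%:R <= N.
  by rewrite (le_trans (card_pairs_le R T)) // ler_pdivrMr // ler_peMr ?sqr_ge0 // ler1n.
suff cover j (A : {set {set T}}) : A \subset pairs T -> #|A|%:R <= j%:R * (d * N) ->
    coverable s0 Good (j * #|edges H|) (fun I : {set {set T}} => fam I /\ I \subset A).
  apply: coverable_sub (cover k (pairs T) _ _) => // [I famI|].
    by split=> //; case: famI.
  rewrite mulrA (le_trans pairsN) // ler_peMl // ltW //.
elim: j A => [|j IH] A AT Aj.
  have A0 : A = set0.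
    by apply/eqP; rewrite -cards_eq0 -leqn0 -(ler_nat R) (le_trans Aj) // mul0r.
  apply: (@coverable_container _ _ _ A) => [|I []//]; apply: HG => //.
  rewrite (_ : copies H A = set0) ?cards0 ?mulr_gt0 ?exprn_gt0 //.
  apply/setP => phi; rewrite [RHS]inE; apply/negP => /copiesP[_].
  have [x [y [_ [_ xy _]]]] := chromatic_cherry chi.
  rewrite A0 subset0 imset_eq0 => /eqP H0.
  by move: xy; rewrite /adj H0 inE.
have [few|many] := ltP #|copies H A|%:R (eps * n ^+ #|V|).
  rewrite -[(_ * _)%N]addn0; apply: coverable_pad.
  by apply: (@coverable_container _ _ _ A) => [|I []//]; apply: HG.
rewrite mulSn; apply: (step _ A (copy_weight R H A) N p tau s0) => //.
- by rewrite p0.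
- by rewrite (le_trans _ pairsN) // ler_nat subset_leq_card.
- by rewrite s0l.
- exact: weighting_copies.
- rewrite Ntau deg_copy_weight (le_trans many) // ler_nat subset_leq_card //.
  by apply/subsetP => phi; rewrite inE sub0set andbT.
- move=> v S vS; have vS0 : v |: S != set0 by apply/set0Pn; exists v; rewrite setU11.
  apply: le_trans (@deg_copy_weight_le R V T H A (v |: S) _ m1 T0 vS0 erefl) _.
  rewrite cardsU1 vS add1n /= -/n -/p /K /tau le_eqVlt; apply/orP; left; apply/eqP.
  move: (2 ^ _ * _)%:R (p ^+ _) (n `^ _) => u x y; field.
  by rewrite gt_eqF.
- move=> I [[_ HI] IA]; split=> // E; apply: contraNN => EI.
  rewrite pnatr_eq0 cards_eq0 -subset0 -HI; apply/subsetP => phi.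
  rewrite inE => /andP[+ /eqP phiE]; rewrite !inE => /andP[-> _] /=.
  apply/forall_inP => e eH; apply: (subsetP EI); rewrite -phiE.
  by apply/imsetP; exists e.
move=> B BA cB; apply: coverable_sub (IH B _ _) => [I [[famI _] IB]//||].
  exact: subset_trans AT.
by move: cB Aj; rewrite -natr1; lra.
Qed.

(** * Counting *)

(** Factor by factor: (t + g - i) / (t - i) is at most (t + g - m) / (t - m) for i < m. *)
Lemma bin_shift_le (t g m : nat) : (m <= t)%N ->
  ('C(t + g, m) * (t - m) ^ m <= 'C(t, m) * (t - m + g) ^ m)%N.
Proof.
move=> mt; rewrite -(leq_pmul2r (fact_gt0 m)) mulnAC bin_ffact [leqRHS]mulnAC bin_ffact.
have step k : (k <= m)%N -> ((t + g) ^_ k * (t - m) ^ k <= t ^_ k * (t - m + g) ^ k)%N.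
  elim: k => // k IH km; rewrite !ffactnSr !expnSr mulnACA [leqRHS]mulnACA.
  by apply: leq_mul; [exact: IH (ltnW km) | nia].
exact: step.
Qed.

Lemma bin_ratio_le (N Q s : nat) : (s <= Q)%N ->
  ('C(N, s) * (Q - s) ^ s <= 'C(Q, s) * N ^ s)%N.
Proof.
move=> sQ; rewrite -(leq_pmul2r (fact_gt0 s)) mulnAC bin_ffact [leqRHS]mulnAC bin_ffact mulnC.
have E x : (x ^ s = \prod_(i < s) x)%N by rewrite prod_nat_const card_ord.
rewrite !ffact_prod !E; apply: leq_mul; apply: leq_prod => i _; last exact: leq_subr.
by rewrite leq_sub2l // ltnW.
Qed.

(** Both sides count, in a set of size M, the m-sets with a marked s-subset; on the left the
    unmarked elements are chosen first. *)
Lemma bin_swap (M m s : nat) : (s <= m <= M)%N ->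
  ('C(M, m - s) * 'C(M - m + s, s) = 'C(M, m) * 'C(m, s))%N.
Proof.
case/andP=> sm mM; have f0 := fact_gt0.
have E1 := bin_fact (leq_trans (leq_subr s m) mM).
have E2 := bin_fact (leq_addl (M - m) s); have E3 := bin_fact mM; have E4 := bin_fact sm.
have EM : (M - (m - s) = M - m + s)%N by lia.
rewrite EM in E1; rewrite addnK in E2.
apply/eqP; rewrite -(eqn_pmul2r (f0 (m - s)%N)) -(eqn_pmul2r (f0 s)) -(eqn_pmul2r (f0 (M - m)%N)).
apply/eqP; transitivity (M`!).
  by rewrite -E1 -E2; ring.
by rewrite -E3 -E4; ring.
Qed.

(** A pair [(E, F)] with [F] inside [E :&: D] becomes a [k]-subset of the disjoint union of [A] and
    [D]: an element of [E] is taken from the copy of [D] exactly when it lies in [F]. *)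
Lemma sum_subsets_exp2 (X : finType) (A D : {set X}) k : D \subset A ->
  (\sum_(E : {set X} | (E \subset A) && (#|E| == k)) 2 ^ #|E :&: D| <= 'C(#|A| + #|D|, k))%N.
Proof.
move=> DA; pose W := [set q : X * bool | (q.1 \in A) && (q.2 ==> (q.1 \in D))].
have cW : #|W| = (#|A| + #|D|)%N.
  have -> : W = setX A [set false] :|: setX D [set true].
    apply/setP => -[x []]; rewrite !inE /= ?andbT ?andbF ?orbF //=.
    by apply/andP/idP => [[]//|xD]; rewrite (subsetP DA).
  rewrite cardsU !cardsX !cards1 !muln1 (_ : _ :&: _ = set0) ?cards0 ?subn0 //.
  by apply/setP => -[x []]; rewrite !inE /= ?andbF.
rewrite -cW -cards_draws.
pose G (q : {set X} * {set X}) := [set z : X * bool | (z.1 \in q.1) && (z.2 == (z.1 \in q.2))].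
pose Q := [set q : {set X} * {set X} | [&& q.1 \subset A, #|q.1| == k & q.2 \subset q.1 :&: D]].
have cQ : #|Q| = (\sum_(E : {set X} | (E \subset A) && (#|E| == k)) 2 ^ #|E :&: D|)%N.
  rewrite -sum1_card (eq_bigl (fun q : {set X} * {set X} =>
    ((q.1 \subset A) && (#|q.1| == k)) && (q.2 \subset q.1 :&: D))) => [|q]; last first.
    by rewrite inE andbA.
  rewrite -(pair_big_dep (fun E : {set X} => (E \subset A) && (#|E| == k))
    (fun E F : {set X} => F \subset E :&: D) (fun _ _ => 1%N)) /=.
  apply: eq_bigr => E _; rewrite sum1_card -card_powerset.
  by apply: eq_card => F; rewrite [RHS]inE.
rewrite -cQ -(card_in_imset (f := G)) => [|[E F] [E' F']].
  apply/subset_leq_card/subsetP => Z /imsetP[[E F]].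
  rewrite [(E, F) \in Q]inE /= => /and3P[EA Ek FE] ->.
  rewrite inE; apply/andP; split.
    apply/subsetP => -[x b]; rewrite !inE /= => /andP[xE /eqP->]; rewrite (subsetP EA) //=.
    by apply/implyP => /(subsetP FE); rewrite inE => /andP[].
  rewrite -(eqP Ek) (_ : G (E, F) = (fun x => (x, x \in F)) @: E).
    by rewrite card_imset // => x y [].
  apply/setP => -[x b]; rewrite inE /=; apply/andP/imsetP => [[xE /eqP->]|[y yE [-> ->]]].
    by exists x.
  by [].
rewrite !inE /= => /and3P[_ _ FE] /and3P[_ _ FE'] /setP GE.
have EE : E = E'.
  apply/setP => x; apply/idP/idP => xE.
    by have := GE (x, x \in F); rewrite !inE /= xE eqxx => /esym/andP[].
  by have := GE (x, x \in F'); rewrite !inE /= xE eqxx => /andP[].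
subst E'; congr pair; apply/setP => x.
have sub (F0 : {set X}) : F0 \subset E :&: D -> x \in F0 -> x \in E.
  by move=> /subsetP F0E /F0E; rewrite inE => /andP[].
have [xE|xE] := boolP (x \in E); last first.
  by apply/idP/idP => xF; case/negP: xE; [exact: sub FE xF | exact: sub FE' xF].
by have := GE (x, x \in F); rewrite !inE /= xE eqxx => /esym/eqP.
Qed.

(* Choosing [E] together with a subset of [E :&: D] amounts to choosing [E] in a set
   of size [#|A| + #|D|]; this gains a factor of [2 ^ h]. *)
Lemma card_heavy_le (R : realType) (X : finType) (S A D : {set X}) (m M : nat) (h : R) :
  D \subset A -> (#|A| + #|D| <= M)%N ->
  #|[set E : {set X} | [&& S \subset E, E \subset A, #|E| == m & h <= #|E :&: D|%:R]]|%:R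
    <= 2 `^ (#|S|%:R - h) * 'C(M, m - #|S|)%:R.
Proof.
move=> DA AM; set Q := [set E | _].
have p2 : 0 < 2 `^ (#|S|%:R - h) :> R by rewrite powR_gt0.
rewrite mulrC -ler_pdivrMr // -powRN opprB.
apply: (@le_trans _ _ (\sum_(E : {set X} | (E \subset A) && (#|E| == m - #|S|)%N) 2 ^+ #|E :&: D|)).
  (* Removing [S] is injective and costs at most [#|S|] elements of [E :&: D]; hence the exponent
     [#|S|%:R - h]. *)
  have inj : {in Q &, injective (fun E : {set X} => E :\: S)}.
    move=> E E'; rewrite !inE => /and4P[SE _ _ _] /and4P[SE' _ _ _] EE.
    by rewrite -(setID E S) -(setID E' S) EE (setIidPr SE) (setIidPr SE').
  rewrite -(card_in_imset inj) mulr_natl -sumr_const.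
  set J := [set _ | _ in Q].
  apply: (@le_trans _ _ (\sum_(E in J) 2 ^+ #|E :&: D|)).
    apply: ler_sum => E1 /imsetP[E]; rewrite inE => /and4P[_ _ _ hE] {E1}->.
    rewrite -powR_mulrn // ler_powR ?ler1n // lerBlDr (le_trans hE) // -natrD ler_nat.
    rewrite -(cardsID S (E :&: D)) setIDAC addnC leq_add2l.
    by rewrite subset_leq_card // subsetIr.
  rewrite [leRHS](bigID (mem J)) /= -[leLHS]addr0 lerD //; last first.
    by rewrite sumr_ge0 // => E _; rewrite exprn_ge0.
  rewrite le_eqVlt; apply/orP; left; apply/eqP; apply: eq_bigl => E.
  apply/idP/andP => [EJ|[]//]; split=> //; case/imsetP: EJ => E'.
  rewrite inE => /and4P[SE EA /eqP <- _] ->; rewrite cardsD (setIidPr SE) eqxx andbT.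
  by rewrite (subset_trans _ EA) // subsetDl.
under eq_bigr do rewrite -natrX.
rewrite -natr_sum ler_nat (leq_trans (sum_subsets_exp2 _ DA)) //.
exact: leq_bin2l.
Qed.

(** A union bound over fingerprints: their union, of size [s], has ['C(#|U|, s)] choices, and it
    arises from at most 2^(L s) sequences of [L] subsets. As [E] contains the union, only [m - s]
    elements are left to choose. *)
Lemma card_coverable_le (R : realType) (X : finType) (U : {set X}) (fam : {set {set X}})
    (s0 L m M : nat) (h : R) (Good : {set X} -> Prop) :
  coverable s0 Good L (fun E => E \in fam) ->
  (forall E, E \in fam -> E \subset U /\ #|E| = m) ->
  (forall A, Good A -> exists2 D : {set X}, D \subset A /\ (#|A| + #|D| <= M)%N &
     forall E, E \in fam -> E \subset A -> h <= #|E :&: D|%:R) ->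
  #|fam|%:R <= \sum_(s < (L * s0).+1)
     'C(#|U|, s)%:R * (2 ^+ (L * s) * (2 `^ (s%:R - h) * 'C(M, m - s)%:R)).
Proof.
move=> [F FP] famU HG.
pose W (T : {ffun 'I_L -> {set X}}) := \bigcup_i T i.
pose FT (T : {ffun 'I_L -> {set X}}) := F [seq T i | i <- enum 'I_L].
pose famT T := [set E in fam |
  [&& W T \subset E, E \subset FT T, (#|W T| <= L * s0)%N & `[< Good (FT T) >]]].
pose b s : R := 2 `^ (s%:R - h) * 'C(M, m - s)%:R.
have b0 s : 0 <= b s by rewrite mulr_ge0 ?powR_ge0.
have famW : fam \subset \bigcup_T famT T.
  apply/subsetP => E Efam; have [T [sT TE EF GF]] := FP E Efam.
  pose T' := [ffun i : 'I_L => nth set0 T i].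
  have T'E : [seq T' i | i <- enum 'I_L] = T.
    rewrite (eq_map (g := nth set0 T \o val)) => [|i]; last by rewrite ffunE.
    rewrite map_comp val_enum_ord -sT; exact: mkseq_nth.
  have T'P i : T' i \subset E /\ (#|T' i| <= s0)%N.
    by rewrite ffunE; apply: TE; rewrite mem_nth // sT.
  apply/bigcupP; exists T' => //; rewrite inE Efam /FT T'E /=; apply/and4P; split=> //.
  - by apply/bigcupsP => i _; case: (T'P i).
  - apply: (@leq_trans (\sum_(i < L) s0)); last by rewrite sum_nat_const card_ord.
    apply: (@leq_trans (\sum_(i < L) #|T' i|)); first exact: card_bigcup_le.
    by apply: leq_sum => i _; case: (T'P i).
  - exact/asboolP.
pose ok T := (W T \subset U) && (#|W T| <= L * s0)%N.
have famT_le T : #|famT T|%:R <= if ok T then b #|W T| else 0.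
  have [->|[E0]] := set_0Vmem (famT T); first by rewrite cards0; case: ifP.
  rewrite inE => /andP[E0fam /and4P[WE0 _ Ws /asboolP GF]].
  rewrite /ok Ws (subset_trans WE0) //=; last by case: (famU _ E0fam).
  have [D [DA AM] hD] := HG _ GF.
  apply: le_trans (card_heavy_le (W T) m h DA AM); rewrite ler_nat.
  apply/subset_leq_card/subsetP => E; rewrite !inE => /andP[Efam /and4P[-> EF _ _]].
  by rewrite EF (famU _ Efam).2 eqxx hD.
apply: (@le_trans _ _ (\sum_T #|famT T|%:R)).
  by rewrite -natr_sum ler_nat (leq_trans (subset_leq_card famW)) ?card_bigcup_le.
apply: le_trans (ler_sum _ (fun T _ => famT_le T)) _.
rewrite -big_mkcond /= (partition_big W
  (fun S : {set X} => (S \subset U) && (#|S| < (L * s0).+1)%N)) //=.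
pose sz (S : {set X}) : 'I_(L * s0).+1 := inord #|S|.
rewrite (partition_big sz xpredT) //=; apply: ler_sum => s _.
apply: (@le_trans _ _ (\sum_(S : {set X} | (S \subset U) && (#|S| == s)) 2 ^+ (L * s) * b s)).
  rewrite [leRHS](eq_bigl (fun S : {set X} =>
    [&& S \subset U, (#|S| < (L * s0).+1)%N & sz S == s])) => [|S]; last first.
    apply: andb_id2l => _; rewrite /sz -val_eqE /=.
    have [Slt|Sge] := ltnP #|S| (L * s0).+1; first by rewrite inordK.
    by rewrite gtn_eqF // (leq_trans (ltn_ord s)).
  rewrite (eq_bigl (fun S : {set X} =>
    [&& S \subset U, (#|S| < (L * s0).+1)%N & sz S == s])) => [|S]; last by rewrite andbA.
  apply: ler_sum => S /and3P[_ Slt /eqP sS].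
  have Ss : #|S| = s by rewrite -sS /sz inordK.
  rewrite (eq_bigr (fun _ => b s)) => [|T /andP[_ /eqP->]]; last by rewrite Ss.
  rewrite sumr_const -[leLHS]mulr_natl ler_wpM2r // -natrX ler_nat.
  apply: (@leq_trans #|ffun_on (mem (powerset S)) : pred {ffun 'I_L -> {set X}}|).
    apply/subset_leq_card/subsetP => T; rewrite unfold_in => /andP[_ /eqP WS].
    apply/ffun_onP => i; rewrite inE -WS; exact: bigcup_sup.
  by rewrite card_ffun_on card_ord card_powerset Ss -expnM mulnC.
rewrite sumr_const -[leLHS]mulr_natl; apply: ler_wpM2r; first by rewrite mulr_ge0 ?exprn_ge0.
by rewrite ler_nat -cards_draws; apply/subset_leq_card/subsetP => S; rewrite unfold_in inE.
Qed.

Lemma exprn_le (R : realDomainType) (n : nat) (a b : R) :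
  0 <= a -> a <= b -> a ^+ n <= b ^+ n.
Proof. by move=> a0 ab; rewrite lerXn2r // nnegrE (le_trans a0). Qed.

(** Three losses of at most [beta ^+ m] each use up three quarters of the exponent [delta * m]: 1 +
    y for passing from t + g to t, 1 + x for the sum over [s] by the binomial theorem, and Z for the
    remaining power (2^(L+1) kappa / x)^s, where s <= alpha m. [bin_swap] turns the choice of
    fingerprints into ['C(m, s)] times a power of kappa. *)
Lemma fingerprint_sum_le (R : realType) (u t g m L q : nat) (delta kappa x y Z alpha : R) :
  let beta := 2 `^ (delta / 4) in
  (m < t)%N -> 0 < kappa -> u%:R <= kappa * (t%:R - m%:R) -> g%:R <= y * (t%:R - m%:R) ->
  q%:R <= alpha * m%:R -> alpha <= 1 -> 0 < x -> 1 <= Z -> 2 ^+ L.+1 * kappa <= Z * x ->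
  0 <= y -> 1 + x <= beta -> 1 + y <= beta -> Z `^ alpha <= beta ->
  \sum_(s < q.+1) 'C(u, s)%:R * (2 ^+ (L * s) * (2 `^ (s%:R - delta * m%:R) * 'C(t + g, m - s)%:R))
    <= 'C(t, m)%:R * 2 `^ (- (delta / 4) * m%:R).
Proof.
move=> beta mt k0 uk gy qm a1 x0 Z1 Zx y0 xb yb Zb.
have beta0 : 0 < beta by rewrite powR_gt0.
have tm0 : 0 < t%:R - m%:R :> R by rewrite subr_gt0 ltr_nat.
have m0 : 0 <= m%:R :> R by [].
have qlem : (q <= m)%N by rewrite -(ler_nat R) (le_trans qm) // ler_piMl.
pose M := (t + g)%N.
have MC : 'C(M, m)%:R <= beta ^+ m * 'C(t, m)%:R :> R.
  have := bin_shift_le g (ltnW mt); rewrite -(ler_nat R) !natrM !natrX natrD.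
  rewrite natrB ?(ltnW mt) // => E.
  have tmm : 0 < (t%:R - m%:R) ^+ m :> R by rewrite exprn_gt0.
  rewrite -(ler_pM2r tmm) (le_trans E) // mulrAC mulrC ler_wpM2r // -exprMn.
  apply: exprn_le; first by rewrite addr_ge0 // ltW.
  apply: (@le_trans _ _ ((1 + y) * (t%:R - m%:R))); first by rewrite mulrDl mul1r lerD2l.
  by rewrite ler_wpM2r // ltW.
have term s : (s <= q)%N ->
    'C(u, s)%:R * (2 ^+ (L * s) * (2 `^ (s%:R - delta * m%:R) * 'C(M, m - s)%:R)) <=
    2 `^ (- (delta * m%:R)) * 'C(M, m)%:R * beta ^+ m * ('C(m, s)%:R * x ^+ s).
  move=> sq; have sm : (s <= m)%N := leq_trans sq qlem.
  have mM : (m <= M)%N by rewrite (leq_trans (ltnW mt)) // leq_addr.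
  have Cu : 'C(u, s)%:R <= kappa ^+ s * 'C(M - m + s, s)%:R.
    have := bin_ratio_le u (leq_addl (M - m) s); rewrite addnK -(ler_nat R) !natrM !natrX => E.
    have Mm : 0 < (M - m)%:R :> R by rewrite ltr0n subn_gt0 (leq_trans mt) // leq_addr.
    rewrite -(ler_pM2r (exprn_gt0 s Mm)) (le_trans E) // mulrAC -exprMn mulrC ler_wpM2r //.
    apply: exprn_le => //; rewrite (le_trans uk) // ler_pM2l //.
    by rewrite natrB // lerD2r ler_nat leq_addr.
  have -> : 2 `^ (s%:R - delta * m%:R) = 2 ^+ s * 2 `^ (- (delta * m%:R)) :> R.
    by rewrite powRD ?powR_mulrn //; apply/implyP => _; rewrite pnatr_eq0.
  have E2 := congr1 (fun k => k%:R : R) (@bin_swap M m s _); rewrite sm mM in E2.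
  have {E2} := E2 isT; rewrite !natrM => E2.
  apply: (@le_trans _ _ (2 `^ (- (delta * m%:R)) *
    ((2 ^+ L.+1 * kappa) ^+ s * ('C(M, m)%:R * 'C(m, s)%:R)))).
    rewrite -E2 exprMn -exprM mulSn addnC exprD.
    set A1 := 'C(u, s)%:R in Cu *; set A2 := 'C(M - m + s, s)%:R in Cu *.
    set A3 := 'C(M, m - s)%:R; set p := 2 `^ _; set P1 := 2 ^+ (L * s); set P2 := 2 ^+ s.
    have -> : A1 * (P1 * (P2 * p * A3)) = (p * P1 * P2 * A3) * A1 by ring.
    have -> : p * (P1 * P2 * kappa ^+ s * (A3 * A2)) = 
      (p * P1 * P2 * A3) * (kappa ^+ s * A2) by ring.
    by rewrite ler_wpM2l // /p /P1 /P2 /A3 !mulr_ge0 ?powR_ge0 ?exprn_ge0.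
  rewrite -!mulrA ler_wpM2l ?powR_ge0 //.
  have -> : 'C(M, m)%:R * (beta ^+ m * ('C(m, s)%:R * x ^+ s)) =
    beta ^+ m * x ^+ s * ('C(M, m)%:R * 'C(m, s)%:R) by ring.
  rewrite ler_wpM2r ?mulr_ge0 //.
  apply: (@le_trans _ _ ((Z * x) ^+ s)).
    by apply: exprn_le; rewrite // mulr_ge0 ?exprn_ge0 // ltW.
  rewrite exprMn ler_wpM2r ?exprn_ge0 ?(ltW x0) //.
  have Z0 : 0 <= Z := le_trans ler01 Z1.
  apply: (@le_trans _ _ (Z `^ (alpha * m%:R))).
    rewrite -powR_mulrn // ler_powR // (le_trans _ qm) // ler_nat //.
  by rewrite powRrM powR_mulrn ?powR_ge0 // exprn_le ?powR_ge0.
apply: (@le_trans _ _ (\sum_(s < q.+1)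
   2 `^ (- (delta * m%:R)) * 'C(M, m)%:R * beta ^+ m * ('C(m, s)%:R * x ^+ s))).
  by apply: ler_sum => s _; apply: term; rewrite -ltnS.
rewrite -mulr_sumr.
have sumx : \sum_(s < q.+1) 'C(m, s)%:R * x ^+ s <= beta ^+ m.
  apply: (@le_trans _ _ ((1 + x) ^+ m)); last first.
    by rewrite exprn_le // addr_ge0 // ltW.
  rewrite exprDn -(big_mkord xpredT (fun s => 'C(m, s)%:R * x ^+ s)).
  rewrite -(big_mkord xpredT (fun i => (1 ^+ (m - i) * x ^+ i) *+ 'C(m, i))).
  rewrite [leRHS](big_cat_nat (n := q.+1)) //= -[leLHS]addr0 lerD //.
    by apply: ler_sum => s _; rewrite expr1n mul1r mulr_natl.
  by apply: sumr_ge0 => s _; rewrite expr1n mul1r mulrn_wge0 // exprn_ge0 // ltW.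
have p0 : 0 <= 2 `^ (- (delta * m%:R)) :> R by rewrite powR_ge0.
have bm : 0 <= beta ^+ m by rewrite exprn_ge0 // ltW.
apply: (@le_trans _ _
  (2 `^ (- (delta * m%:R)) * (beta ^+ m * 'C(t, m)%:R) * beta ^+ m * beta ^+ m)).
  apply: ler_pM => //; [by rewrite !mulr_ge0 | | by rewrite ler_wpM2r // ler_wpM2l].
  by apply: sumr_ge0 => s _; rewrite mulr_ge0 // exprn_ge0 // ltW.
rewrite le_eqVlt; apply/orP; left; apply/eqP.
have bE : beta ^+ m = 2 `^ (delta / 4 * m%:R) by rewrite powRrM powR_mulrn // powR_ge0.
rewrite bE.
have -> : - (delta / 4) * m%:R = - (delta * m%:R) +
    delta / 4 * m%:R + delta / 4 * m%:R + delta / 4 * m%:R by field.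
rewrite !powRD; try by apply/implyP => _; rewrite pnatr_eq0.
by ring.
Qed.

(** Colours are residues modulo [r.+1]. A class exceeds n / (r + 1) by at most 1, which costs the
    term n / 2. *)
Lemma turan_exists (R : realType) (r n : nat) :
  exists c : 'I_n -> 'I_r.+1,
   (1 - r.+1%:R^-1) * (n%:R ^+ 2 / 2) - n%:R / 2 <= #|pairs 'I_n :\: mono c|%:R :> R.
Proof.
pose c (i : 'I_n) : 'I_r.+1 := inord (i %% r.+1); exists c.
have r0 : 0 < r.+1%:R :> R by [].
have class_le j : #|[set i | c i == j]|%:R <= n%:R / r.+1%:R + 1 :> R.
  apply: (@le_trans _ _ (n %/ r.+1).+1%:R).
    rewrite ler_nat -[X in (_ <= X)%N]card_ord.
    pose f (i : 'I_n) : 'I_(n %/ r.+1).+1 := inord (i %/ r.+1).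
    rewrite -(card_in_imset (f := f)) ?max_card // => i k; rewrite !inE => /eqP ij /eqP kj.
    move/(congr1 val); rewrite /= !inordK ?ltnS ?leq_div2r ?(ltnW (ltn_ord _)) // => E.
    have := congr1 val (etrans ij (esym kj)); rewrite /= !inordK ?ltn_pmod // => E'.
    by apply: val_inj; rewrite /= (divn_eq i r.+1) (divn_eq k r.+1) E E'.
  by rewrite -natr1 lerD2r ler_pdivlMr // -natrM ler_nat leq_trunc_div.
have e1 : npairs R (fun x y => c x == c y) setT setT <= n%:R * (n%:R / r.+1%:R + 1).
  apply: le_trans (sum_le_card (b := n%:R / r.+1%:R + 1) _) _ => [x _|].
    apply: le_trans (class_le (c x)); rewrite -sumr1_card big_mkcond [leRHS]big_mkcond /=.
    by apply: ler_sum => y _; rewrite !inE eq_sym; case: eqP.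
  by rewrite cardsT card_ord.
have e2 : npairs R (fun x y => c x != c y) setT setT = 2 * #|pairs 'I_n :\: mono c|%:R.
  rewrite -npairs_edges => [|a]; last by rewrite !inE => /andP[_ /eqP].
  apply: eq_npairs => x y _ _; rewrite in_setD mono2 inE cards2.
  by have [->|_] := eqVneq x y; rewrite ?eqxx ?andbT.
have := npairs_neq R c; rewrite e2 card_ord; move: e1.
move: (npairs _ _ _ _) #|_|%:R => v w; move: (r.+1%:R^-1) (n%:R) => k n'; lra.
Qed.

Lemma powR_ln_ratio (R : realType) (a b : R) : 1 < a -> 0 < b -> a `^ (ln b / ln a) = b.
Proof.
move=> a1 b0; have a0 := lt_trans ltr01 a1.
by rewrite /powR gt_eqF // divfK ?lnK ?posrE // gt_eqF // ln_gt0.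
Qed.

(** * From sets of pairs to labelled graphs *)

Section FreeGraphs.
Variables (V T : finType) (H : sgraph V).

Lemma edges_pairs (G : sgraph T) : edges G \subset pairs T.
Proof. by apply/subsetP => d dG; rewrite inE (edge_card2 dG). Qed.

Lemma subgraph_free_copies (G : sgraph T) : subgraph_free H G -> copies H (edges G) = set0.
Proof.
move=> free; apply/setP => phi; rewrite [RHS]inE; apply/negP => phiG.
have [phi_inj phiE] := copiesP phiG.
case/negP: free; apply/existsP; exists ([set phi x | x in V], image_edges H phi).
apply/andP; split.
  rewrite /is_subgraph /= phiE; apply/forall_inP => _ /imsetP[e _ ->].
  by apply: imsetS; apply/subsetP.
by apply/existsP; exists phi; rewrite /= !eqxx !andbT; apply/injectiveP.
Qed.

Lemma partite_subgraph_free k (c : T -> 'I_k) (G : sgraph T) :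
  (k < chromatic_number H)%N -> [disjoint edges G & mono c] -> subgraph_free H G.
Proof.
move=> kH dis; apply/negP => /existsP[K /andP[/andP[KG _] /existsP[f /and3P[_ _ /eqP fE]]]].
move: kH; rewrite ltnNge kpartite_chromatic //.
apply/existsP; exists [ffun x => c (f x)]; apply/forallP => x; apply/forallP => y.
apply/implyP => xy; rewrite !ffunE -mono2 (disjointFr dis) //.
rewrite (subsetP KG) // -fE; apply/imsetP; exists [set x; y] => //.
by rewrite imsetU !imset_set1.
Qed.

Lemma delta_partite_mono (R : realType) (delta : R) k (c : T -> 'I_k) (G : sgraph T) :
  #|edges G :&: mono c|%:R <= delta * #|edges G|%:R -> delta_partite delta k G.
Proof.
move=> cG; apply/existsP; exists (edges G :&: mono c); rewrite subsetIl cG /=.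
apply/existsP; exists [ffun x => c x]; apply/forallP => x; apply/forallP => y.
apply/implyP; rewrite /adj /= !inE => /andP[/[swap] xy]; rewrite xy /= !ffunE.
by rewrite -mono2 inE.
Qed.

Lemma free_graphs_ge k (c : T -> 'I_k) m : (k < chromatic_number H)%N ->
  ('C(#|pairs T :\: mono c|, m) <= #|[set G : sgraph T | subgraph_free H G & #|edges G| == m]|)%N.
Proof.
move=> kH; rewrite -cards_draws -(card_imset _ (val_inj : injective (@edges T))).
apply/subset_leq_card/subsetP => E; rewrite inE => /andP[Ec Em].
have EP : [forall e in E, #|e| == 2%N].
  by apply/forall_inP => e /(subsetP Ec); rewrite !inE => /andP[].
apply/imsetP; exists (SGraph EP) => //; rewrite inE Em andbT.
apply: (@partite_subgraph_free k c) => //=.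
by rewrite disjoints_subset (subset_trans Ec) // setDE subsetIr.
Qed.

End FreeGraphs.

(** The two bounds on [m] give d <= 2 g q <= delta q / 8. As k <= 1/2, [turan] is at least q / 4,
    whence m >= q / 8. *)
Lemma dense_defect (R : realFieldType) (q turan k g delta m d : R) :
  0 <= q -> k <= 2^-1 -> turan = (1 - k) * (q / 2) -> 0 < delta ->
  g <= 8^-1 -> g <= delta / 16 -> turan - g * q <= m -> m + d <= turan + g * q ->
  d <= delta * m.
Proof.
move=> q0 k2 -> delta0 g8 gd mge md.
have h1 : g * q <= 8^-1 * q by rewrite ler_wpM2r.
have h2 : g * q <= delta / 16 * q by rewrite ler_wpM2r.
have h3 : 0 <= (2^-1 - k) * (q / 2) by rewrite mulr_ge0 ?subr_ge0 // divr_ge0.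
have h4 : delta * (q / 8) <= delta * m by rewrite ler_wpM2l ?(ltW delta0) //; lra.
by lra.
Qed.

(** * Choice of the constants and final comparison *)

Theorem theorem1p6 (R : realType) (V : finType) (H : sgraph V)
    (chiH : (3 <= chromatic_number H)%N) (delta : R) (delta_gt0 : 0 < delta) :
  exists2 C : R, 0 < C &
    forall eta : R, 0 < eta ->
    exists n0 : nat, forall n m : nat, (n0 <= n)%N ->
      C * n%:R `^ (2 - 1 / m2 R H) <= m%:R -> (m <= 'C(n, 2))%N ->
      #|[set G : sgraph 'I_n | [&& subgraph_free H G, #|edges G| == m
           & ~~ delta_partite delta (chromatic_number H - 1)%N G]]|%:R
      <= eta * #|[set G : sgraph 'I_n | subgraph_free H G & #|edges G| == m]|%:R.
Proof.
have m1 := m2_ge1 R chiH; have m0 : 0 < m2 R H := lt_le_trans ltr01 m1.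
have [r r0 chiE] : exists2 r, (0 < r)%N & chromatic_number H = r.+2.
  by exists (chromatic_number H).-2; case: chromatic_number chiH => [|[|[|k]]].
have colH : kpartite r.+2 H by rewrite -chiE chromatic_kpartite.
rewrite chiE subn1 [r.+2.-1]/=.
pose beta : R := 2 `^ (delta / 4).
have beta1 : 1 < beta.
  have d4 : 0 < delta / 4 by rewrite divr_gt0.
  have := gt0_ltr_powR d4 (x := 1) (y := 2); rewrite powR1; apply; rewrite ?nnegrE //.
  by rewrite ltr1n.
pose y := beta - 1; have y0 : 0 < y by rewrite subr_gt0.
pose g := Num.min 8^-1 (delta / 16).
have g0 : 0 < g by rewrite lt_min invr_gt0 ltr0n divr_gt0.
have g8 : g <= 8^-1 by rewrite ge_min lexx.
have gd : g <= delta / 16 by rewrite ge_min lexx orbT.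
(* When m is not close to t, t - m >= g n^2 / 2. Then the excess 2 g1 n^2 of a container is at most
   y (t - m), and the at most n^2 / 2 pairs are at most kap (t - m). *)
pose g1 := y * g / 4; have g10 : 0 < g1 by rewrite !divr_gt0 ?mulr_gt0.
pose kap := g^-1; have kap0 : 0 < kap by rewrite invr_gt0.
have [epsd epsd0 [nd stabd]] := stability colH g0.
have [eps eps0 [n1 stab]] := stability colH g10.
have [L [n2 cov]] := free_coverable chiH eps0.
(* The summand 1 makes [ln Z] positive. *)
pose Z := 2 ^+ L.+1 * kap / y + 1.
have Y0 : 0 < 2 ^+ L.+1 * kap / y by rewrite divr_gt0 ?mulr_gt0 ?exprn_gt0.
have Z1 : 1 < Z by rewrite ltrDr.
pose alpha := Num.min 1 (ln beta / ln Z).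
have lnZ : 0 < ln Z by rewrite ln_gt0.
have alpha0 : 0 < alpha by rewrite lt_min ltr01 divr_gt0 // ln_gt0.
have Zalpha : Z `^ alpha <= beta.
  rewrite -[leRHS](powR_ln_ratio Z1 (lt_trans ltr01 beta1)).
  by rewrite ler_powR ?(ltW Z1) // ge_min lexx orbT.
(* The first summand bounds the total fingerprint size L s0 <= 2 L n^(2 - 1/m_2) by alpha m; the
   second gives m >= n. *)
pose C := 2 * L%:R / alpha + 1.
have C1 : 1 <= C by rewrite lerDr divr_ge0 ?mulr_ge0 // ltW.
exists C => [|eta eta0]; first exact: lt_le_trans C1.
have [|n3 n3P] := @powR_unbounded R (delta / 4) eta^-1; first by rewrite divr_gt0.
pose b1 := Num.bound g1^-1; pose b2 := Num.bound g^-1.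
exists (maxn 1 (maxn nd (maxn n1 (maxn n2 (maxn n3 (maxn b1 b2)))))) => n m.
rewrite !geq_max => /and4P[n_gt0 nnd nn1 /and4P[nn2 nn3 nb1 nb2]].
rewrite div1r => mC mn.
have n0 : 0 < n%:R :> R by rewrite ltr0n.
have nge1 : 1 <= n%:R :> R by rewrite ler1n.
have ng1 : g1^-1 <= n%:R.
  by rewrite (le_trans (ltW (archi_boundP _))) ?ler_nat // invr_ge0 ltW.
have ng : g^-1 <= n%:R.
  by rewrite (le_trans (ltW (archi_boundP _))) ?ler_nat // invr_ge0 ltW.
have gn1 : 1 <= g1 * n%:R by rewrite -ler_pdivrMl // mulr1.
have gn : 1 <= g * n%:R by rewrite -ler_pdivrMl // mulr1.
have cn : #|'I_n| = n := card_ord n.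
set bad := [set G | _]; set good := [set G | _ & _].
pose k : R := r.+1%:R^-1.
have k2 : k <= 2^-1 by rewrite lef_pV2 ?posrE // ler_nat ltnS.
have k0 : 0 < k by rewrite invr_gt0.
pose turan := (1 - k) * (n%:R ^+ 2 / 2).
have n2_0 : 0 < n%:R ^+ 2 :> R by rewrite exprn_gt0.
have [dense|sparse] := leP (turan - g * n%:R ^+ 2) m%:R.
  rewrite (_ : bad = set0) ?cards0 ?mulr_ge0 // ?ltW //.
  apply/setP => G; rewrite [RHS]inE; apply/negP; rewrite inE => /and3P[free /eqP Gm /negP]; apply.
  have [|||c cP] := stabd 'I_n (edges G); first by rewrite cn.
    by move=> d; exact: edge_card2.
    by rewrite subgraph_free_copies // cards0 mulr_gt0 ?exprn_gt0 ?cn.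
  apply: (delta_partite_mono (c := c)); rewrite Gm.
  rewrite cn Gm -/k -/turan in cP.
  exact: (dense_defect (ltW n2_0) k2 erefl delta_gt0 g8 gd dense cP).
have [c0] := turan_exists R r n; set t := #|_ :\: _|; rewrite -/k -/turan => tP.
have ng1n : n%:R <= g1 * n%:R ^+ 2 by rewrite expr2 mulrA ler_peMl.
have ngn : n%:R <= g * n%:R ^+ 2 by rewrite expr2 mulrA ler_peMl.
have tm : g * n%:R ^+ 2 / 2 <= t%:R - m%:R by clear -tP sparse ngn; lra.
have mt : (m < t)%N.
  by rewrite -(ltr_nat R) -subr_gt0 (lt_le_trans _ tm) // divr_gt0 ?mulr_gt0.
have z0 : 0 <= 2 * g1 * n%:R ^+ 2 := mulr_ge0 (mulr_ge0 (ler0n _ 2) (ltW g10)) (ltW n2_0).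
(* One g1 n^2 is the error in stability; the other absorbs the n / 2 lost in the Turán colouring. *)
pose gg := Num.truncn (2 * g1 * n%:R ^+ 2).
have /andP[ggl ggu] := truncn_itv z0.
pose Good (A : {set {set 'I_n}}) :=
  exists c : 'I_n -> 'I_r.+1, (#|A| + #|A :&: mono c| <= t + gg)%N.
have [|s0 s0u covA] := cov 'I_n; first by rewrite cn.
have {covA} covG := covA Good _.
pose fam := [set edges G | G in bad].
have famP E : E \in fam -> exists2 G, E = edges G & G \in bad by case/imsetP => G; exists G.
have cov_fam : coverable s0 Good L (fun E => E \in fam).
  apply: coverable_sub (covG _) => [E /famP[G -> ]|A Apairs fewA].
    by rewrite inE => /andP[free _]; rewrite edges_pairs subgraph_free_copies.
  have [|||c cP] := stab 'I_n A; first by rewrite cn.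
    by move=> a /(subsetP Apairs); rewrite inE => /eqP.
    by [].
  exists c; rewrite -ltnS -(ltr_nat R) -addnS !natrD.
  move: cP; rewrite cn -/k -/turan => cP; rewrite -/gg in ggu.
  by clear -cP ggu tP ng1n n0; lra.
have s0q : (L * s0)%:R <= alpha * m%:R.
  have := mC; rewrite natrM; rewrite cn in s0u; move: s0u; set P := _ `^ _ => s0u CP.
  have aC : alpha * C = 2 * L%:R + alpha by rewrite mulrDr mulr1 mulrCA divff ?mulr1 ?gt_eqF.
  have := ler_wpM2l (ltW alpha0) CP; rewrite mulrA aC; apply: le_trans.
  apply: (@le_trans _ _ (L%:R * (2 * P))); first by rewrite ler_wpM2l.
  have aP : 0 <= alpha * P by rewrite mulr_ge0 ?powR_ge0 // ltW.
  by clear -aP; lra.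
have fam_le : #|fam|%:R <= 'C(t, m)%:R * 2 `^ (- (delta / 4) * m%:R).
  apply: le_trans (card_coverable_le (U := pairs 'I_n) (m := m) (M := t + gg)
     (h := delta * m%:R) cov_fam _ _) _.
  - move=> E /famP[G -> ]; rewrite inE => /and3P[_ /eqP -> _].
    by rewrite edges_pairs.
  - move=> A [c cA]; exists (A :&: mono c); first by rewrite subsetIl.
    move=> E /famP[G ->]; rewrite inE => /and3P[_ /eqP Gm nd'] GA.
    rewrite leNgt; apply: contra nd' => /ltW lt.
    by apply: (delta_partite_mono (c := c)); rewrite Gm -(setIidPl GA) -setIA.
  apply: (@fingerprint_sum_le _ _ _ _ _ _ _ _ kap y y Z alpha) => //.
  - apply: le_trans (card_pairs_le R _) _; rewrite cn.
    by rewrite -(ler_pM2l g0) [leRHS]mulrA mulfV ?gt_eqF // mul1r mulrA.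
  - apply: (le_trans ggl); apply: (@le_trans _ _ (y * (g * n%:R ^+ 2 / 2))).
      by rewrite /g1; clear; lra.
    by rewrite ler_wpM2l // ltW.
  - by rewrite ge_min lexx.
  - exact: ltW.
  - rewrite /Z mulrDl divfK ?gt_eqF // mul1r lerDl ltW //.
  - exact: ltW.
  - by rewrite /y addrC subrK.
  - by rewrite /y addrC subrK.
rewrite -(card_imset (mem bad) (val_inj : injective (@edges 'I_n))) -/fam.
apply: le_trans fam_le _; rewrite mulrC; apply: ler_pM; rewrite ?powR_ge0 //; last first.
  by rewrite ler_nat (@free_graphs_ge _ _ H _ c0) // chiE.
rewrite mulNr powRN -(invrK eta) lef_pV2 ?posrE ?invr_gt0 ?powR_gt0 //.
have nm : n%:R <= m%:R :> R.
  apply: le_trans mC; rewrite -[leLHS]mul1r ler_pM // -[leLHS]powRr1 ?ler0n //.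
  rewrite ler_powR // lerBrDr -lerBrDl.
  have m1' : (m2 R H)^-1 <= 1 by rewrite invf_le1.
  by clear -m1'; lra.
(* Since 2^m > m >= n >= n3, already m^(delta/4) is at least 1 / eta. *)
rewrite mulrC powRrM powR_mulrn //; apply: le_trans (n3P m _) _.
  by rewrite (leq_trans nn3) // -(ler_nat R).
rewrite ge0_ler_powR ?nnegrE ?exprn_ge0 ?divr_ge0 ?(ltW delta_gt0) //.
by rewrite -natrX ler_nat ltnW // ltn_expl.
Qed.
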